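(* Let $\Gamma$ be a discrete countable non-torsion group and let $\Lambda$ be any discrete countable group such that either (1) $\Lambda$ admits a finite dimensional unitary representation $\Lambda\to U(d)$, $d\ge1$, that is not trivial (i.e. some element of $\Lambda$ is not mapped to the identity), or (2) $\Lambda$ has a finite conjugacy class other than $\{e\}$. Then $C^*(\Lambda\wr\Gamma)$ has a non-finite quotient.
   Context: A group is non-torsion if it contains an element of infinite order. $\Lambda\wr\Gamma=\big(\bigoplus_{\Gamma}\Lambda\big)\rtimes\Gamma$ is the (restricted) wreath product, with $\Gamma$ acting on the direct sum by left translation of the index set. $C^*(\cdot)$ is the full group C*-algebra. A unital C*-algebra is finite if every isometry in it is a unitary, and non-finite otherwise (equivalently, it contains a partial isometry $V$ with $VV^*\leq V^*V$ and $VV^*\ne V^*V$). *)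

(* Defs.v *)
From HB Require Import structures.
From mathcomp Require Import all_boot all_order all_algebra.
From mathcomp Require Import finmap complex monalg.
From mathcomp Require Import all_classical all_reals topology normedtype sequences.
From mathcomp Require Import ring.

Set Implicit Arguments.
Unset Strict Implicit.
Unset Printing Implicit Defensive.

Import Order.TTheory GRing.Theory Num.Theory.
Import numFieldNormedType.Exports.

Local Open Scope classical_set_scope.
Local Open Scope complex_scope.
Local Open Scope ring_scope.
Local Open Scope quotient_scope.

HB.mixin Record isStarAlgebra (R : realType) A of GRing.Algebra R[i] A := {
  star : A -> A;
  starK : involutive star;
  starD : {morph star : x y / x + y};
  starM : forall x y : A, star (x * y) = star y * star x;
  starZ : forall (a : R[i]) (x : A), star (a *: x) = (a^* : R[i]) *: star x
}.

#[short(type="starAlgType")]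
HB.structure Definition StarAlgebra (R : realType) :=
  {A of isStarAlgebra R A & GRing.Algebra R[i] A}.

Notation "x ^^*" := (star x)
  (at level 1, left associativity, format "x ^^*") : ring_scope.

Definition is_isometry (R : realType) (A : starAlgType R) (v : A) : Prop :=
  v^^* * v = 1.

Definition is_unitary (R : realType) (A : starAlgType R) (v : A) : Prop :=
  v^^* * v = 1 /\ v * v^^* = 1.

Definition finite_algebra (R : realType) (A : starAlgType R) : Prop :=
  forall v : A, is_isometry v -> is_unitary v.

HB.mixin Record hasCStarSeminorm (R : realType) A of StarAlgebra R A := {
  cnorm : A -> R;
  cnormD : forall x y : A, cnorm (x + y) <= cnorm x + cnorm y;
  cnormZ : forall (a : R[i]) (x : A), (cnorm (a *: x))%:C = `|a| * (cnorm x)%:C;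
  cnormM : forall x y : A, cnorm (x * y) <= cnorm x * cnorm y;
  cnorm_star_mul : forall x : A, cnorm (x^^* * x) = cnorm x ^+ 2;
  cnorm1_neq0 : cnorm 1 != 0
}.

#[short(type="preCStarAlgType")]
HB.structure Definition PreCStarAlgebra (R : realType) :=
  {A of hasCStarSeminorm R A & StarAlgebra R A}.

Definition cauchy_sequence (R : realType) (A : preCStarAlgType R)
    (u : nat -> A) : Prop :=
  forall e : R, 0 < e ->
    exists N, forall m n, (N <= m)%N -> (N <= n)%N -> cnorm (u m - u n) < e.

Definition converges_to (R : realType) (A : preCStarAlgType R)
    (u : nat -> A) (l : A) : Prop :=
  forall e : R, 0 < e -> exists N, forall n, (N <= n)%N -> cnorm (u n - l) < e.

(* The library's normed modules have no join with its rings below numDomainType,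
   hence the norm and its completeness are spelled out. *)
HB.mixin Record isCStarAlgebra (R : realType) A of PreCStarAlgebra R A := {
  cnorm_eq0 : forall x : A, cnorm x = 0 -> x = 0;
  cnorm_complete : forall u : nat -> A,
    cauchy_sequence u -> exists l, converges_to u l
}.

#[short(type="cstarAlgType")]
HB.structure Definition CStarAlgebra (R : realType) :=
  {A of isCStarAlgebra R A & PreCStarAlgebra R A}.

(* Proper two-sided *-ideals: the library's algebras are non-zero. *)
Record starIdeal (R : realType) (A : starAlgType R) := StarIdeal {
  ideal_set :> A -> Prop;
  ideal_proper : ~ ideal_set 1;
  ideal0 : ideal_set 0;
  idealD : forall x y, ideal_set x -> ideal_set y -> ideal_set (x + y);
  idealMl : forall a x, ideal_set x -> ideal_set (a * x);
  idealMr : forall a x, ideal_set x -> ideal_set (x * a);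
  idealS : forall x, ideal_set x -> ideal_set x^^*
}.

Section StarTheory.
Variables (R : realType) (A : starAlgType R).
Implicit Types x y : A.

Lemma starN x : (- x)^^* = - x^^*.
Proof. by rewrite -scaleN1r starZ rmorphN rmorph1 scaleN1r. Qed.

Lemma starB x y : (x - y)^^* = x^^* - y^^*.
Proof. by rewrite starD starN. Qed.

Lemma star0 : 0^^* = 0 :> A.
Proof. by apply: (addrI 0^^*); rewrite -starD !addr0. Qed.

Lemma star1 : 1^^* = 1 :> A.
Proof. by rewrite -[LHS]mulr1 -[X in _ * X]starK -starM mulr1 starK. Qed.

Variable I : starIdeal A.

Lemma idealZ (a : R[i]) x : I x -> I (a *: x).
Proof. by move=> Ix; rewrite -[x]mul1r scalerAl; exact: idealMl. Qed.

Lemma idealN x : I x -> I (- x).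
Proof. by rewrite -scaleN1r; exact: idealZ. Qed.

End StarTheory.

Section Quotient.
Variables (R : realType) (A : starAlgType R) (I : starIdeal A).

Definition ideal_rel (x y : A) : bool := `[< I (x - y) >].

Lemma ideal_rel_refl : reflexive ideal_rel.
Proof. by move=> x; apply/asboolP; rewrite subrr; exact: ideal0. Qed.

Lemma ideal_rel_sym : symmetric ideal_rel.
Proof. by move=> x y; apply/asboolP/asboolP => /idealN; rewrite opprB. Qed.

Lemma ideal_rel_trans : transitive ideal_rel.
Proof.
move=> y x z /asboolP xy /asboolP yz; apply/asboolP.
by have := idealD xy yz; rewrite addrA subrK.
Qed.

Canonical ideal_equiv :=
  EquivRel ideal_rel ideal_rel_refl ideal_rel_sym ideal_rel_trans.

Definition quot := {eq_quot ideal_equiv}.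

HB.instance Definition _ := Choice.on quot.
HB.instance Definition _ := EqQuotient.on quot.

Implicit Types (p q r : quot) (x y : A).

Lemma quotP x y : \pi_quot x = \pi_quot y <-> I (x - y).
Proof. by split=> [/eqmodP/asboolP|Ixy]; last exact/eqmodP/asboolP. Qed.

Definition quot_zero : quot := \pi_quot 0.
Definition quot_one : quot := \pi_quot 1.
Definition quot_add p q : quot := \pi_quot (repr p + repr q).
Definition quot_opp p : quot := \pi_quot (- repr p).
Definition quot_mul p q : quot := \pi_quot (repr p * repr q).
Definition quot_scale (a : R[i]) p : quot := \pi_quot (a *: repr p).
Definition quot_star p : quot := \pi_quot (repr p)^^*.

Lemma repr_quot x : I (repr (\pi_quot x) - x).
Proof. by apply/quotP; rewrite reprK. Qed.

Lemma pi_add x y : quot_add (\pi_quot x) (\pi_quot y) = \pi_quot (x + y).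
Proof.
apply/quotP; rewrite opprD addrACA.
by apply: idealD; exact: repr_quot.
Qed.

Lemma pi_opp x : quot_opp (\pi_quot x) = \pi_quot (- x).
Proof. by apply/quotP; rewrite -opprD; apply/idealN/repr_quot. Qed.

Lemma pi_mul x y : quot_mul (\pi_quot x) (\pi_quot y) = \pi_quot (x * y).
Proof.
apply/quotP; set x' := repr _; set y' := repr _.
rewrite (_ : _ - _ = (x' - x) * y' + x * (y' - y)); last first.
  by rewrite mulrBl mulrBr addrA subrK.
by apply: idealD; [apply/idealMr/repr_quot|apply/idealMl/repr_quot].
Qed.

Lemma pi_scale a x : quot_scale a (\pi_quot x) = \pi_quot (a *: x).
Proof. by apply/quotP; rewrite -scalerBr; apply/idealZ/repr_quot. Qed.

Lemma pi_star x : quot_star (\pi_quot x) = \pi_quot x^^*.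
Proof. by apply/quotP; rewrite -starB; apply/idealS/repr_quot. Qed.

Lemma quot_ind (P : quot -> Prop) : (forall x, P (\pi_quot x)) -> forall p, P p.
Proof. by move=> Px p; rewrite -[p]reprK. Qed.

Lemma quot_addA : associative quot_add.
Proof.
by elim/quot_ind=> x; elim/quot_ind=> y; elim/quot_ind=> z; rewrite !pi_add addrA.
Qed.

Lemma quot_addC : commutative quot_add.
Proof. by elim/quot_ind=> x; elim/quot_ind=> y; rewrite !pi_add addrC. Qed.

Lemma quot_add0 : left_id quot_zero quot_add.
Proof. by elim/quot_ind=> x; rewrite pi_add add0r. Qed.

Lemma quot_addN : left_inverse quot_zero quot_opp quot_add.
Proof. by elim/quot_ind=> x; rewrite pi_opp pi_add addNr. Qed.

HB.instance Definition _ :=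
  GRing.isZmodule.Build quot quot_addA quot_addC quot_add0 quot_addN.

Lemma quot_mulA : associative quot_mul.
Proof.
by elim/quot_ind=> x; elim/quot_ind=> y; elim/quot_ind=> z; rewrite !pi_mul mulrA.
Qed.

Lemma quot_mul1l : left_id quot_one quot_mul.
Proof. by elim/quot_ind=> x; rewrite pi_mul mul1r. Qed.

Lemma quot_mul1r : right_id quot_one quot_mul.
Proof. by elim/quot_ind=> x; rewrite pi_mul mulr1. Qed.

Lemma quot_mulDl : left_distributive quot_mul quot_add.
Proof.
elim/quot_ind=> x; elim/quot_ind=> y; elim/quot_ind=> z.
by rewrite pi_add !pi_mul pi_add mulrDl.
Qed.

Lemma quot_mulDr : right_distributive quot_mul quot_add.
Proof.
elim/quot_ind=> x; elim/quot_ind=> y; elim/quot_ind=> z.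
by rewrite pi_add !pi_mul pi_add mulrDr.
Qed.

Lemma quot_oner_neq0 : quot_one != quot_zero.
Proof. by apply/eqP => /quotP; rewrite subr0; exact: ideal_proper. Qed.

HB.instance Definition _ := GRing.Zmodule_isNzRing.Build quot
  quot_mulA quot_mul1l quot_mul1r quot_mulDl quot_mulDr quot_oner_neq0.

Lemma quot_scaleA a b p : quot_scale a (quot_scale b p) = quot_scale (a * b) p.
Proof. by elim/quot_ind: p => x; rewrite !pi_scale scalerA. Qed.

Lemma quot_scale1 : left_id 1 quot_scale.
Proof. by elim/quot_ind=> x; rewrite pi_scale scale1r. Qed.

Lemma quot_scaleDr : right_distributive quot_scale +%R.
Proof.
move=> a; elim/quot_ind=> x; elim/quot_ind=> y.
by rewrite [_ + _]pi_add !pi_scale [RHS]pi_add scalerDr.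
Qed.

Lemma quot_scaleDl p : {morph quot_scale^~ p : a b / a + b}.
Proof.
elim/quot_ind: p => x a b.
by rewrite !pi_scale [RHS]pi_add scalerDl.
Qed.

HB.instance Definition _ := GRing.Zmodule_isLmodule.Build R[i] quot
  quot_scaleA quot_scale1 quot_scaleDr quot_scaleDl.

Lemma quot_scale_mull (a : R[i]) p q : quot_scale a (p * q) = quot_scale a p * q.
Proof.
elim/quot_ind: p => x; elim/quot_ind: q => y.
by rewrite [_ * _]pi_mul !pi_scale [RHS]pi_mul scalerAl.
Qed.

HB.instance Definition _ := GRing.Lmodule_isLalgebra.Build R[i] quot
  quot_scale_mull.

Lemma quot_scale_mulr (a : R[i]) p q : quot_scale a (p * q) = p * quot_scale a q.
Proof.
elim/quot_ind: p => x; elim/quot_ind: q => y.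
by rewrite [_ * _]pi_mul !pi_scale [RHS]pi_mul scalerAr.
Qed.

HB.instance Definition _ := GRing.Lalgebra_isAlgebra.Build R[i] quot
  quot_scale_mulr.

Lemma quot_starK : involutive quot_star.
Proof. by elim/quot_ind=> x; rewrite !pi_star starK. Qed.

Lemma quot_starD : {morph quot_star : p q / p + q}.
Proof.
elim/quot_ind=> x; elim/quot_ind=> y.
by rewrite [_ + _]pi_add !pi_star [RHS]pi_add starD.
Qed.

Lemma quot_starM p q : quot_star (p * q) = quot_star q * quot_star p.
Proof.
elim/quot_ind: p => x; elim/quot_ind: q => y.
by rewrite [_ * _]pi_mul !pi_star [RHS]pi_mul starM.
Qed.

Lemma quot_starZ (a : R[i]) p : quot_star (a *: p) = (a^* : R[i]) *: quot_star p.
Proof.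
elim/quot_ind: p => x.
by rewrite [_ *: _]pi_scale !pi_star [RHS]pi_scale starZ.
Qed.

HB.instance Definition _ := isStarAlgebra.Build R quot
  quot_starK quot_starD quot_starM quot_starZ.

End Quotient.

Definition norm_closed (R : realType) (A : preCStarAlgType R) (S : A -> Prop) : Prop :=
  forall (u : nat -> A) (x : A),
    (forall n, S (u n)) -> converges_to u x -> S x.

(* A / I for a closed two-sided ideal I (closed two-sided ideals of a
   C*-algebra are automatically *-invariant); the case I = A left out by
   starIdeal would give the zero algebra, which is finite. *)
Definition has_nonfinite_quotient (R : realType) (A : cstarAlgType R) : Prop :=
  exists I : starIdeal A, norm_closed I /\ ~ finite_algebra (quot I).

HB.mixin Record isHilbert (R : realType) H of CompleteNormedModule R[i] H := {
  inner : H -> H -> R[i];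
  inner_linear : forall (a : R[i]) (x y z : H),
    inner (a *: x + y) z = a * inner x z + inner y z;
  inner_conj : forall x y : H, inner y x = (inner x y)^*;
  inner_norm : forall x : H, `|x| ^+ 2 = inner x x
}.

#[short(type="hilbertType")]
HB.structure Definition Hilbert (R : realType) :=
  {H of isHilbert R H & CompleteNormedModule R[i] H}.

Section SeminormTheory.
Variables (R : realType) (A : preCStarAlgType R).
Implicit Types x y : A.

Lemma cnorm0 : cnorm (0 : A) = 0.
Proof. by apply: (@complexI R); rewrite -(scale0r 1) cnormZ normr0 mul0r. Qed.

Lemma cnormN x : cnorm (- x) = cnorm x.
Proof.
by apply: (@complexI R); rewrite -scaleN1r cnormZ normrN normr1 mul1r.
Qed.

Lemma cnorm_ge0 x : 0 <= cnorm x.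
Proof.
have := cnormD x (- x).
by rewrite subrr cnorm0 cnormN -mulr2n pmulrn_lge0.
Qed.

Lemma cnorm_distC x y : cnorm (x - y) = cnorm (y - x).
Proof. by rewrite -cnormN opprB. Qed.

Lemma cnorm_dist x y z : cnorm (x - z) <= cnorm (x - y) + cnorm (y - z).
Proof. by rewrite -[x - z](subrKA y) cnormD. Qed.

Lemma cnorm_distl x y : cnorm x <= cnorm y + cnorm (x - y).
Proof. by rewrite -[x in X in X <= _](subrK y) addrC cnormD. Qed.

Lemma cnorm_star_le x : cnorm x <= cnorm x^^*.
Proof.
have [->|x0] := eqVneq (cnorm x) 0; first exact: cnorm_ge0.
have := cnormM x^^* x.
by rewrite cnorm_star_mul expr2 ler_pM2r // lt0r x0 cnorm_ge0.
Qed.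

Lemma cnorm_star x : cnorm x^^* = cnorm x.
Proof.
by apply/le_anti; rewrite -{2}[x]starK !cnorm_star_le.
Qed.

End SeminormTheory.

(* The separated completion: Cauchy sequences modulo null sequences. *)
Section Completion.
Variables (R : realType) (A : preCStarAlgType R).
Implicit Types (x y : A).

Record cauchyseq := CauchySeq {
  cseq :> nat -> A;
  cseqP : cauchy_sequence cseq
}.

HB.instance Definition _ := gen_eqMixin cauchyseq.
HB.instance Definition _ := gen_choiceMixin cauchyseq.

Implicit Types (u v w : cauchyseq).

Lemma cauchyseq_eq u v : (forall n, u n = v n) -> u = v.
Proof.
case: u v => u Pu [v Pv] /= /funext uv; move: Pu Pv.
by rewrite uv => Pu Pv; rewrite (Prop_irrelevance Pu Pv).
Qed.

Lemma cauchyseq_bounded u : exists2 M, 0 < M & forall n, cnorm (u n) <= M.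
Proof.
have [N uN] := cseqP u ltr01.
pose M := \sum_(i < N.+1) cnorm (u i) + 1.
have S0 (i : 'I_N.+1) : cnorm (u i) <= \sum_(i < N.+1) cnorm (u i).
  by rewrite (bigD1 i) //= lerDl sumr_ge0 // => j _; exact: cnorm_ge0.
exists M; first by rewrite ltr_wpDl // sumr_ge0 // => j _; exact: cnorm_ge0.
move=> n; have [nN|Nn] := ltnP n N.+1.
  by rewrite (le_trans (S0 (Ordinal nN))) // lerDl.
rewrite (le_trans (cnorm_distl _ (u N))) // lerD //.
  exact: S0 (Ordinal (leqnn N.+1)).
by apply/ltW/uN => //; exact: ltnW.
Qed.

Lemma cst_cauchy x : cauchy_sequence (fun _ => x).
Proof. by move=> e e0; exists 0%N => m n _ _; rewrite subrr cnorm0. Qed.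

Lemma add_cauchy u v : cauchy_sequence (fun n => u n + v n).
Proof.
move=> e e0; have e2 : 0 < e / 2 by rewrite divr_gt0.
have [N uN] := cseqP u e2; have [M vM] := cseqP v e2.
exists (maxn N M) => m n; rewrite !geq_max => /andP[Nm Mm] /andP[Nn Mn].
rewrite opprD addrACA (le_lt_trans (cnormD _ _)) // [e]splitr ltrD //.
  exact: uN.
exact: vM.
Qed.

Lemma opp_cauchy u : cauchy_sequence (fun n => - u n).
Proof.
move=> e e0; have [N uN] := cseqP u e0.
by exists N => m n Nm Nn; rewrite -opprD cnormN uN.
Qed.

Lemma mul_cauchy u v : cauchy_sequence (fun n => u n * v n).
Proof.
move=> e e0.
have [a a0 ua] := cauchyseq_bounded u; have [b b0 vb] := cauchyseq_bounded v.
have [|N uN] := cseqP u (_ : 0 < e / 2 / b); first by rewrite !divr_gt0.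
have [|M vM] := cseqP v (_ : 0 < e / 2 / a); first by rewrite !divr_gt0.
exists (maxn N M) => m n; rewrite !geq_max => /andP[Nm Mm] /andP[Nn Mn].
rewrite (_ : _ - _ = (u m - u n) * v m + u n * (v m - v n)); last first.
  by rewrite mulrBl mulrBr addrA subrK.
rewrite (le_lt_trans (cnormD _ _)) // [e]splitr ltr_leD //.
  rewrite (le_lt_trans (cnormM _ _)) //.
  rewrite (@le_lt_trans _ _ (cnorm (u m - u n) * b)) //.
    by rewrite ler_wpM2l ?cnorm_ge0.
  by rewrite -ltr_pdivlMr // uN.
rewrite (le_trans (cnormM _ _)) //.
rewrite (@le_trans _ _ (a * cnorm (v m - v n))) //.
  by rewrite ler_wpM2r ?cnorm_ge0.
by rewrite mulrC -ler_pdivlMr // ltW // vM.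
Qed.

Lemma normc_re (a : R[i]) : `|a| = (complex.Re `|a|)%:C.
Proof. by rewrite normc_def. Qed.

Lemma cnormZ_re (a : R[i]) x : cnorm (a *: x) = complex.Re `|a| * cnorm x.
Proof. by apply: (@complexI R); rewrite cnormZ [in LHS]normc_re rmorphM. Qed.

Lemma normc_re_ge0 (a : R[i]) : 0 <= complex.Re `|a|.
Proof. by rewrite normc_def; exact: sqrtr_ge0. Qed.

Lemma scale_cauchy (a : R[i]) u : cauchy_sequence (fun n => a *: u n).
Proof.
move=> e e0; have a1 : 0 < complex.Re `|a| + 1.
  by rewrite ltr_wpDl // normc_re_ge0.
have [|N uN] := cseqP u (_ : 0 < e / (complex.Re `|a| + 1)).
  by rewrite divr_gt0.
exists N => m n Nm Nn; rewrite -scalerBr cnormZ_re.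
rewrite (@le_lt_trans _ _ ((complex.Re `|a| + 1) * cnorm (u m - u n))) //.
  by rewrite ler_wpM2r ?cnorm_ge0 // lerDl.
by rewrite mulrC -ltr_pdivlMr // uN.
Qed.

Lemma star_cauchy u : cauchy_sequence (fun n => (u n)^^*).
Proof.
move=> e e0; have [N uN] := cseqP u e0.
by exists N => m n Nm Nn; rewrite -starB cnorm_star uN.
Qed.

Definition cs_cst x := CauchySeq (cst_cauchy x).
Definition cs_add u v := CauchySeq (add_cauchy u v).
Definition cs_opp u := CauchySeq (opp_cauchy u).
Definition cs_mul u v := CauchySeq (mul_cauchy u v).
Definition cs_scale a u := CauchySeq (scale_cauchy a u).
Definition cs_star u := CauchySeq (star_cauchy u).

Lemma cs_addA : associative cs_add.
Proof. by move=> u v w; apply: cauchyseq_eq => n /=; rewrite addrA. Qed.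

Lemma cs_addC : commutative cs_add.
Proof. by move=> u v; apply: cauchyseq_eq => n /=; rewrite addrC. Qed.

Lemma cs_add0 : left_id (cs_cst 0) cs_add.
Proof. by move=> u; apply: cauchyseq_eq => n /=; rewrite add0r. Qed.

Lemma cs_addN : left_inverse (cs_cst 0) cs_opp cs_add.
Proof. by move=> u; apply: cauchyseq_eq => n /=; rewrite addNr. Qed.

HB.instance Definition _ :=
  GRing.isZmodule.Build cauchyseq cs_addA cs_addC cs_add0 cs_addN.

Lemma cs_mulA : associative cs_mul.
Proof. by move=> u v w; apply: cauchyseq_eq => n /=; rewrite mulrA. Qed.

Lemma cs_mul1l : left_id (cs_cst 1) cs_mul.
Proof. by move=> u; apply: cauchyseq_eq => n /=; rewrite mul1r. Qed.

Lemma cs_mul1r : right_id (cs_cst 1) cs_mul.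
Proof. by move=> u; apply: cauchyseq_eq => n /=; rewrite mulr1. Qed.

Lemma cs_mulDl : left_distributive cs_mul cs_add.
Proof. by move=> u v w; apply: cauchyseq_eq => n /=; rewrite mulrDl. Qed.

Lemma cs_mulDr : right_distributive cs_mul cs_add.
Proof. by move=> u v w; apply: cauchyseq_eq => n /=; rewrite mulrDr. Qed.

Lemma cs_oner_neq0 : cs_cst 1 != cs_cst 0.
Proof. by apply/eqP => -[] /(congr1 (@^~ 0%N)) /eqP; rewrite oner_eq0. Qed.

HB.instance Definition _ := GRing.Zmodule_isNzRing.Build cauchyseq
  cs_mulA cs_mul1l cs_mul1r cs_mulDl cs_mulDr cs_oner_neq0.

Lemma cs_scaleA a b u : cs_scale a (cs_scale b u) = cs_scale (a * b) u.
Proof. by apply: cauchyseq_eq => n /=; rewrite scalerA. Qed.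

Lemma cs_scale1 : left_id 1 cs_scale.
Proof. by move=> u; apply: cauchyseq_eq => n /=; rewrite scale1r. Qed.

Lemma cs_scaleDr : right_distributive cs_scale +%R.
Proof. by move=> a u v; apply: cauchyseq_eq => n /=; rewrite scalerDr. Qed.

Lemma cs_scaleDl u : {morph cs_scale^~ u : a b / a + b}.
Proof. by move=> a b; apply: cauchyseq_eq => n /=; rewrite scalerDl. Qed.

HB.instance Definition _ := GRing.Zmodule_isLmodule.Build R[i] cauchyseq
  cs_scaleA cs_scale1 cs_scaleDr cs_scaleDl.

Lemma cs_scaleAl a u v : cs_scale a (u * v) = cs_scale a u * v.
Proof. by apply: cauchyseq_eq => n /=; rewrite scalerAl. Qed.

HB.instance Definition _ :=
  GRing.Lmodule_isLalgebra.Build R[i] cauchyseq cs_scaleAl.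

Lemma cs_scaleAr a u v : cs_scale a (u * v) = u * cs_scale a v.
Proof. by apply: cauchyseq_eq => n /=; rewrite scalerAr. Qed.

HB.instance Definition _ :=
  GRing.Lalgebra_isAlgebra.Build R[i] cauchyseq cs_scaleAr.

Lemma cs_starK : involutive cs_star.
Proof. by move=> u; apply: cauchyseq_eq => n /=; rewrite starK. Qed.

Lemma cs_starD : {morph cs_star : u v / u + v}.
Proof. by move=> u v; apply: cauchyseq_eq => n /=; rewrite starD. Qed.

Lemma cs_starM u v : cs_star (u * v) = cs_star v * cs_star u.
Proof. by apply: cauchyseq_eq => n /=; rewrite starM. Qed.

Lemma cs_starZ (a : R[i]) u : cs_star (a *: u) = (a^* : R[i]) *: cs_star u.
Proof. by apply: cauchyseq_eq => n /=; rewrite starZ. Qed.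

HB.instance Definition _ :=
  isStarAlgebra.Build R cauchyseq cs_starK cs_starD cs_starM cs_starZ.

Definition null_sequence u : Prop :=
  forall e : R, 0 < e -> exists N, forall n, (N <= n)%N -> cnorm (u n) < e.

Lemma null_proper : ~ null_sequence 1.
Proof.
have c1 : 0 < cnorm (1 : A) by rewrite lt0r cnorm1_neq0 cnorm_ge0.
by move=> /(_ _ c1)[N /(_ _ (leqnn N))]; rewrite ltxx.
Qed.

Lemma null0 : null_sequence 0.
Proof. by move=> e e0; exists 0%N => n _; rewrite cnorm0. Qed.

Lemma nullD u v : null_sequence u -> null_sequence v -> null_sequence (u + v).
Proof.
move=> nu nv e e0; have e2 : 0 < e / 2 by rewrite divr_gt0.
have [N uN] := nu _ e2; have [M vM] := nv _ e2.
exists (maxn N M) => n; rewrite geq_max => /andP[Nn Mn].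
by rewrite (le_lt_trans (cnormD _ _)) // [e]splitr ltrD // ?uN // vM.
Qed.

Lemma nullMl u v : null_sequence v -> null_sequence (u * v).
Proof.
move=> nv e e0; have [a a0 ua] := cauchyseq_bounded u.
have [|N vN] := nv (e / a) _; first by rewrite divr_gt0.
exists N => n Nn; rewrite (le_lt_trans (cnormM _ _)) //.
rewrite (@le_lt_trans _ _ (a * cnorm (v n))) //.
  by rewrite ler_wpM2r ?cnorm_ge0.
by rewrite mulrC -ltr_pdivlMr // vN.
Qed.

Lemma nullS u : null_sequence u -> null_sequence u^^*.
Proof.
by move=> nu e /nu[N uN]; exists N => n Nn; rewrite cnorm_star uN.
Qed.

Lemma nullMr u v : null_sequence v -> null_sequence (v * u).
Proof. by move=> nv; rewrite -[_ * _]starK starM; exact/nullS/nullMl/nullS. Qed.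

Definition null_ideal : starIdeal cauchyseq :=
  StarIdeal null_proper null0 nullD nullMl nullMr nullS.

Definition completion := quot null_ideal.

HB.instance Definition _ := StarAlgebra.on completion.

Definition to_completion x : completion := \pi_completion (cs_cst x).

End Completion.

Section CompletionNorm.
Variables (R : realType) (A : preCStarAlgType R).
Implicit Types (x y : A) (u v : cauchyseq A) (p q : completion A).

Lemma cnorm_distr x y : `|cnorm x - cnorm y| <= cnorm (x - y).
Proof.
rewrite ler_norml; apply/andP; split; last by rewrite lerBlDl cnorm_distl.
by rewrite lerNl opprB lerBlDl cnorm_distC cnorm_distl.
Qed.

Definition limnorm u : R := limn (fun n => cnorm (u n)).

Lemma cvg_limnorm u : cnorm (u n) @[n --> \oo] --> limnorm u.
Proof.
suff : cvgn (fun n => cnorm (u n)) by [].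
apply: cauchy_cvg; apply: cauchy_exP => e e0.
have [N uN] := cseqP u e0; exists (cnorm (u N)).
exists N => // n /= Nn; rewrite /ball /=.
by rewrite (le_lt_trans (cnorm_distr _ _)) // uN.
Qed.

Lemma limnorm_unique u (l : R) :
  cnorm (u n) @[n --> \oo] --> l -> limnorm u = l.
Proof. exact: cvg_lim. Qed.

Lemma limnorm_le u (e : R) :
  (exists N, forall n, (N <= n)%N -> cnorm (u n) <= e) -> limnorm u <= e.
Proof.
by move=> [N uN]; apply: (cvgr_to_le (cvg_limnorm (u := u))); exists N.
Qed.

Lemma limnorm_lt u (e : R) :
  limnorm u < e -> exists N, forall n, (N <= n)%N -> cnorm (u n) < e.
Proof.
rewrite -subr_gt0 => e0.
have /cvgrPdist_lt/(_ _ e0)[N _ uN] := @cvg_limnorm u.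
exists N => n Nn; have := uN n Nn; rewrite /= ltr_norml => /andP[+ _].
by rewrite opprB ltrD2l ltrN2.
Qed.

Lemma limnorm_quot u v : null_sequence (u - v) -> limnorm u = limnorm v.
Proof.
move=> uv; apply: limnorm_unique; apply/cvgrPdist_lt => e e0.
have e2 : 0 < e / 2 by rewrite divr_gt0.
have /cvgrPdist_lt/(_ _ e2)[N _ vN] := @cvg_limnorm v.
have [M uvM] := uv _ e2.
exists (maxn N M) => // n /=; rewrite geq_max => /andP[Nn Mn].
rewrite -(subrKA (cnorm (v n))) (le_lt_trans (ler_normD _ _)) //.
rewrite [e]splitr ltrD //; first exact: vN.
by rewrite distrC (le_lt_trans (cnorm_distr _ _)) // uvM.
Qed.

Definition completion_norm p : R := limnorm (repr p).

Lemma completion_norm_pi u : completion_norm (\pi_(completion A) u) = limnorm u.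
Proof. by apply: limnorm_quot; exact: (@repr_quot _ _ (null_ideal A)). Qed.

Lemma completion_ind (P : completion A -> Prop) :
  (forall u, P (\pi_(completion A) u)) -> forall p, P p.
Proof. exact: quot_ind. Qed.

Lemma completion_normD p q :
  completion_norm (p + q) <= completion_norm p + completion_norm q.
Proof.
elim/completion_ind: p => u; elim/completion_ind: q => v.
rewrite [_ + _]pi_add !completion_norm_pi.
apply: (ler_cvg_to (cvg_limnorm (u := u + v))).
  by apply: cvgD; exact: cvg_limnorm.
by near=> n; exact: cnormD.
Unshelve. all: by end_near. Qed.

Lemma completion_normZ (a : R[i]) p :
  (completion_norm (a *: p))%:C = `|a| * (completion_norm p)%:C.
Proof.
rewrite normc_re -rmorphM; congr _%:C.
elim/completion_ind: p => u; rewrite [_ *: _]pi_scale !completion_norm_pi.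
apply: limnorm_unique; under eq_fun do rewrite /= cnormZ_re.
by apply: cvgMl_tmp; exact: cvg_limnorm.
Qed.

Lemma completion_normM p q :
  completion_norm (p * q) <= completion_norm p * completion_norm q.
Proof.
elim/completion_ind: p => u; elim/completion_ind: q => v.
rewrite [_ * _]pi_mul !completion_norm_pi.
apply: (ler_cvg_to (cvg_limnorm (u := u * v))).
  by apply: cvgM; exact: cvg_limnorm.
by near=> n; exact: cnormM.
Unshelve. all: by end_near. Qed.

Lemma completion_norm_star p : completion_norm (p^^* * p) = completion_norm p ^+ 2.
Proof.
elim/completion_ind: p => u.
rewrite [_^^*]pi_star [_ * _]pi_mul !completion_norm_pi.
apply: limnorm_unique; under eq_fun do rewrite /= cnorm_star_mul expr2.
by apply: cvgM; exact: cvg_limnorm.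
Qed.

Lemma completion_norm_to x : completion_norm (to_completion x) = cnorm x.
Proof.
rewrite completion_norm_pi; apply: limnorm_unique.
exact: (@cvg_cst _ (cnorm x)).
Qed.

Lemma completion_norm1_neq0 : completion_norm 1 != 0.
Proof. by rewrite [1]/(to_completion 1) completion_norm_to cnorm1_neq0. Qed.

HB.instance Definition _ := hasCStarSeminorm.Build R (completion A)
  completion_normD completion_normZ completion_normM completion_norm_star
  completion_norm1_neq0.

Lemma completion_norm_eq0 p : completion_norm p = 0 -> p = 0.
Proof.
elim/completion_ind: p => u; rewrite completion_norm_pi => u0.
apply/quotP; rewrite subr0 => e e0; apply: limnorm_lt.
by rewrite u0.
Qed.

Lemma to_completionB x y :
  to_completion (x - y) = to_completion x - to_completion y.
Proof.
rewrite /to_completion [- \pi_(completion A) _]pi_opp [RHS]pi_add; congr (\pi_(completion A) _).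
exact: cauchyseq_eq.
Qed.

Lemma to_completion_dense p (e : R) :
  0 < e -> exists x, cnorm (p - to_completion x) < e.
Proof.
elim/completion_ind: p => u e0; have e2 : 0 < e / 2 by rewrite divr_gt0.
have [N uN] := cseqP u e2; exists (u N).
rewrite /to_completion [- \pi_(completion A) _]pi_opp [_ + _]pi_add [cnorm _]completion_norm_pi.
rewrite (@le_lt_trans _ _ (e / 2)) //; last by rewrite ltr_pdivrMr // ltr_pMr // ltr1n.
by apply: limnorm_le; exists N => n Nn; apply/ltW/uN.
Qed.

Lemma completion_complete (f : nat -> completion A) :
  cauchy_sequence f -> exists l, converges_to f l.
Proof.
move=> cf.
have /choice[x xP] n : exists x, cnorm (f n - to_completion x) < n.+1%:R^-1.
  by apply: to_completion_dense; rewrite invr_gt0 ltr0n.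
have small (e : R) : 0 < e ->
    exists N, forall n, (N <= n)%N -> cnorm (f n - to_completion (x n)) < e.
  move=> e0; have /cvgrPdist_lt/(_ _ e0)[N _ PN] := @cvg_harmonic R.
  exists N => n /PN /=; rewrite sub0r normrN ger0_norm ?invr_ge0 ?ler0n //.
  exact/lt_trans/xP.
have cx : cauchy_sequence x.
  move=> e e0; have e3 : 0 < e / 3 by rewrite divr_gt0.
  have [N PN] := small _ e3; have [M PM] := cf _ e3.
  exists (maxn N M) => m n; rewrite !geq_max => /andP[Nm Mm] /andP[Nn Mn].
  rewrite -completion_norm_to to_completionB [completion_norm _]/(cnorm _).
  rewrite (le_lt_trans (cnorm_dist _ (f m) _)) //.
  rewrite (le_lt_trans (lerD (lexx _) (cnorm_dist _ (f n) _))) //.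
  have -> : e = e / 3 + (e / 3 + e / 3).
    by rewrite -!mulrDl -mulr2n -mulrS -(mulr_natr e) mulfK // pnatr_eq0.
  apply: ltrD; first by rewrite cnorm_distC; exact: PN.
  by apply: ltrD; [exact: PM|exact: PN].
exists (\pi_(completion A) (CauchySeq cx)) => e e0.
have e2 : 0 < e / 2 by rewrite divr_gt0.
have [N PN] := small _ e2; have [M PM] := cx _ e2.
exists (maxn N M) => n; rewrite geq_max => /andP[Nn Mn].
rewrite (le_lt_trans (cnorm_dist _ (to_completion (x n)) _)) //.
rewrite [e]splitr ltr_leD // ?PN //.
rewrite /to_completion [- \pi_(completion A) _]pi_opp [_ + _]pi_add [cnorm _]completion_norm_pi.
by apply: limnorm_le; exists M => k Mk; apply/ltW/PM.
Qed.

HB.instance Definition _ := isCStarAlgebra.Build R (completion A)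
  completion_norm_eq0 completion_complete.

End CompletionNorm.

Definition galg (R : realType) (G : groupType) := {malg R[i][G]}.

HB.instance Definition _ (R : realType) (G : groupType) :=
  GRing.Lmodule.on (galg R G).

Section GroupAlgebra.
Variables (R : realType) (G : groupType).
Local Notation CG := (galg R G).
Implicit Types (f h k : CG) (a b : R[i]) (x y : G).

Definition delta x : CG := << 1 *g x >>.

(* The linear extension of phi : G -> V to C[G]. *)
Definition glift (V : lmodType R[i]) (phi : G -> V) f : V :=
  \sum_(x <- msupp f) f@_x *: phi x.

Definition galg_one : CG := delta 1%g.

Definition galg_mul f h : CG :=
  glift (fun x => glift (fun y => delta (x * y)%g) h) f.

Definition galg_star f : CG := \sum_(x <- msupp f) ((f@_x)^* : R[i]) *: delta x^-1%g.

Section Glift.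
Variable V : lmodType R[i].
Implicit Types phi psi : G -> V.

Lemma gliftEw phi f (D : {fset G}) : (msupp f `<=` D)%fset ->
  glift phi f = \sum_(x <- D) f@_x *: phi x.
Proof.
move=> fD; rewrite /glift; apply: big_fset_incl => // x _ xf.
by rewrite mcoeff_outdom // scale0r.
Qed.

Lemma gliftP phi : linear (glift phi).
Proof.
move=> a f h; set D := (msupp f `|` msupp h `|` msupp (a *: f + h))%fset.
have fD : (msupp f `<=` D)%fset by rewrite /D -fsetUA fsubsetUl.
have hD : (msupp h `<=` D)%fset by rewrite /D fsetUAC fsubsetUr.
rewrite (gliftEw _ fD) (gliftEw _ hD) (@gliftEw phi _ D) ?fsubsetUr //.
rewrite scaler_sumr -big_split /=; apply: eq_bigr => x _.
by rewrite mcoeffD mcoeffZ scalerDl scalerA.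
Qed.

HB.instance Definition _ phi :=
  GRing.isLinear.Build R[i] CG V _ (glift phi) (gliftP phi).

Lemma glift_delta phi x : glift phi (delta x) = phi x.
Proof.
rewrite (@gliftEw _ _ [fset x]%fset) ?msuppU_le // big_seq_fset1.
by rewrite mcoeffUU scale1r.
Qed.

Lemma gliftD phi psi f :
  glift (fun x => phi x + psi x) f = glift phi f + glift psi f.
Proof. by rewrite -big_split; apply: eq_bigr => x _; rewrite scalerDr. Qed.

Lemma gliftZ phi a f : glift (fun x => a *: phi x) f = a *: glift phi f.
Proof.
by rewrite scaler_sumr; apply: eq_bigr => x _; rewrite !scalerA mulrC.
Qed.

Lemma eq_glift phi psi f : phi =1 psi -> glift phi f = glift psi f.
Proof. by move=> pp; apply: eq_bigr => x _; rewrite pp. Qed.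

End Glift.

Lemma glift_comp (V W : lmodType R[i]) (T : V -> W) (phi : G -> V) f :
  linear T -> T (glift phi f) = glift (T \o phi) f.
Proof.
move=> linT; pose mT := GRing.isLinear.Build R[i] V W _ T linT.
pose T' : {linear V -> W} := HB.pack T mT.
rewrite -[T _]/(T' _) linear_sum; apply: eq_bigr => x _.
by rewrite linearZ.
Qed.

Lemma glift_id f : glift delta f = f.
Proof.
rewrite [RHS]monalgE; apply: eq_bigr => x _.
by apply/malgP => y; rewrite mcoeffZ !mcoeffU mulrnAr mulr1.
Qed.

Definition ltrans x f : CG := glift (fun y => delta (x * y)%g) f.

Lemma ltransP x : linear (ltrans x).
Proof. exact: gliftP. Qed.

Lemma ltransM x y f : ltrans x (ltrans y f) = ltrans (x * y)%g f.
Proof.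
rewrite {2}/ltrans (glift_comp _ _ (ltransP x)); apply: eq_glift => z /=.
by rewrite /ltrans glift_delta mulgA.
Qed.

Lemma galg_mulE f h : galg_mul f h = glift (ltrans^~ h) f.
Proof. by []. Qed.

Lemma galg_mulP h : linear (galg_mul^~ h).
Proof. by move=> a f k; rewrite !galg_mulE gliftP. Qed.

Lemma ltrans_mul x f h : ltrans x (galg_mul f h) = galg_mul (ltrans x f) h.
Proof.
rewrite galg_mulE (glift_comp _ _ (ltransP x)).
rewrite {2}/ltrans (glift_comp _ _ (galg_mulP h)).
by apply: eq_glift => y /=; rewrite ltransM galg_mulE glift_delta.
Qed.

Lemma galg_mulA : associative galg_mul.
Proof.
move=> f h k; rewrite galg_mulE [galg_mul f h]galg_mulE.
rewrite (glift_comp _ _ (galg_mulP k)); apply: eq_glift => x /=.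
exact: ltrans_mul.
Qed.

Lemma galg_mul1l : left_id galg_one galg_mul.
Proof.
move=> f; rewrite galg_mulE glift_delta -[RHS]glift_id.
by apply: eq_glift => x; rewrite mul1g.
Qed.

Lemma galg_mul1r : right_id galg_one galg_mul.
Proof.
move=> f; rewrite galg_mulE -[RHS]glift_id; apply: eq_glift => x.
by rewrite /ltrans glift_delta mulg1.
Qed.

Lemma galg_mulDl : left_distributive galg_mul +%R.
Proof. by move=> f h k; rewrite !galg_mulE linearD. Qed.

Lemma galg_mulDr : right_distributive galg_mul +%R.
Proof.
move=> f h k; rewrite !galg_mulE -gliftD; apply: eq_glift => x.
by rewrite /ltrans linearD.
Qed.

Lemma galg_oner_neq0 : galg_one != 0.
Proof. by rewrite /galg_one /delta monalgU_eq0 oner_eq0. Qed.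

HB.instance Definition _ := GRing.Zmodule_isNzRing.Build (galg R G)
  galg_mulA galg_mul1l galg_mul1r galg_mulDl galg_mulDr galg_oner_neq0.

Lemma galg_scaleAl a f h : a *: (f * h) = a *: f * h.
Proof. by rewrite [f * h]galg_mulE -linearZ. Qed.

HB.instance Definition _ :=
  GRing.Lmodule_isLalgebra.Build R[i] (galg R G) galg_scaleAl.

Lemma galg_scaleAr a f h : a *: (f * h) = f * (a *: h).
Proof.
rewrite [f * h]galg_mulE -gliftZ; apply: eq_glift => x.
by rewrite /ltrans linearZ.
Qed.

HB.instance Definition _ :=
  GRing.Lalgebra_isAlgebra.Build R[i] (galg R G) galg_scaleAr.

Lemma deltaM x y : delta x * delta y = delta (x * y)%g.
Proof. by rewrite [LHS]galg_mulE glift_delta /ltrans glift_delta. Qed.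

Lemma galg_starEw f (D : {fset G}) : (msupp f `<=` D)%fset ->
  galg_star f = \sum_(x <- D) ((f@_x)^* : R[i]) *: delta x^-1%g.
Proof.
move=> fD; apply: big_fset_incl => // x _ xf.
by rewrite mcoeff_outdom // rmorph0 scale0r.
Qed.

Lemma galg_starD : {morph galg_star : f h / f + h}.
Proof.
move=> f h; set D := (msupp f `|` msupp h `|` msupp (f + h))%fset.
have fD : (msupp f `<=` D)%fset by rewrite /D -fsetUA fsubsetUl.
have hD : (msupp h `<=` D)%fset by rewrite /D fsetUAC fsubsetUr.
rewrite (galg_starEw fD) (galg_starEw hD) (@galg_starEw _ D) ?fsubsetUr //.
rewrite -big_split /=; apply: eq_bigr => x _.
by rewrite mcoeffD rmorphD scalerDl.
Qed.

Lemma galg_starZ a f : galg_star (a *: f) = (a^* : R[i]) *: galg_star f.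
Proof.
set D := (msupp f `|` msupp (a *: f))%fset.
rewrite (@galg_starEw f D) ?fsubsetUl // (@galg_starEw _ D) ?fsubsetUr //.
rewrite scaler_sumr; apply: eq_bigr => x _.
by rewrite mcoeffZ rmorphM scalerA.
Qed.

Lemma galg_star_delta x : galg_star (delta x) = delta x^-1%g.
Proof.
rewrite (@galg_starEw _ [fset x]%fset) ?msuppU_le // big_seq_fset1.
by rewrite mcoeffUU rmorph1 scale1r.
Qed.

Lemma galg_star0 : galg_star 0 = 0.
Proof. by rewrite /galg_star msupp0 big_seq_fset0. Qed.

Definition lincomb (s : seq G) (c : G -> R[i]) (F : G -> CG) : CG :=
  \sum_(x <- s) c x *: F x.

Lemma lincomb_nil c F : lincomb [::] c F = 0.
Proof. exact: big_nil. Qed.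

Lemma lincomb_cons x s c F : lincomb (x :: s) c F = c x *: F x + lincomb s c F.
Proof. exact: big_cons. Qed.

Lemma eq_lincomb s c F F' : F =1 F' -> lincomb s c F = lincomb s c F'.
Proof. by move=> /funext->. Qed.

Lemma galg_starE f :
  galg_star f = lincomb (msupp f) (fun x => (f@_x)^*) (fun x => delta x^-1%g).
Proof. by []. Qed.

Lemma gliftE (phi : G -> CG) f : glift phi f = lincomb (msupp f) (mcoeff^~ f) phi.
Proof. by []. Qed.

Lemma lincomb_star s c F :
  galg_star (lincomb s c F) =
  lincomb s (fun x => (c x)^*) (fun x => galg_star (F x)).
Proof.
elim: s => [|x s IHs]; first by rewrite !lincomb_nil galg_star0.
by rewrite !lincomb_cons galg_starD IHs galg_starZ.
Qed.

Lemma lincomb_mull s c F h : lincomb s c F * h = lincomb s c (fun x => F x * h).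
Proof.
elim: s => [|x s IHs]; first by rewrite !lincomb_nil mul0r.
by rewrite !lincomb_cons mulrDl IHs galg_scaleAl.
Qed.

Lemma lincomb_mulr s c F h : h * lincomb s c F = lincomb s c (fun x => h * F x).
Proof.
elim: s => [|x s IHs]; first by rewrite !lincomb_nil mulr0.
by rewrite !lincomb_cons mulrDr IHs galg_scaleAr.
Qed.

Lemma galg_starK : involutive galg_star.
Proof.
move=> f; rewrite [galg_star f]galg_starE lincomb_star -[RHS]glift_id gliftE.
congr lincomb; apply/funext => x; first exact: conjCK.
by rewrite galg_star_delta invgK.
Qed.

Lemma galg_starM f h : galg_star (f * h) = galg_star h * galg_star f.
Proof.
rewrite [f * h]galg_mulE gliftE lincomb_star [galg_star f]galg_starE lincomb_mulr.
apply: eq_lincomb => x.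
rewrite /ltrans gliftE lincomb_star [galg_star h]galg_starE lincomb_mull.
apply: eq_lincomb => y.
by rewrite galg_star_delta invgM deltaM.
Qed.

HB.instance Definition _ := isStarAlgebra.Build R (galg R G)
  galg_starK galg_starD galg_starM galg_starZ.

End GroupAlgebra.

Section ComplexHilbert.
Variable R : realType.

Lemma complex_complete (F : set_system R[i]^o) :
  ProperFilter F -> cauchy F -> cvg F.
Proof.
move=> FF /cauchyP cF.
have ball_re (z w : R[i]) (e : R) :
    `|z - w| < e%:C -> `|complex.Re z - complex.Re w| < e.
  by move=> zw; rewrite -ltcR (le_lt_trans _ zw) // -raddfB normc_ge_Re.
have ball_im (z w : R[i]) (e : R) :
    `|z - w| < e%:C -> `|complex.Im z - complex.Im w| < e.
  move=> zw; rewrite -ltcR (le_lt_trans _ zw) // -raddfB.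
  by rewrite normc_def lecR -sqrtr_sqr ler_wsqrtr // lerDr sqr_ge0.
have cvg_part (p : R[i] -> R) : (forall (z w : R[i]) (e : R),
    `|z - w| < e%:C -> `|p z - p w| < e) -> cvg (p @ F).
  move=> pP; apply: cauchy_cvg; apply: cauchy_exP => e e0.
  have [|z Fz] := cF e%:C; first by rewrite ltcR.
  exists (p z); suff : F (p @^-1` ball (p z) e) by [].
  by apply: filterS Fz => w; rewrite -!ball_normE; exact: pP.
have /cvg_ex[a /= Fa] := cvg_part _ ball_re.
have /cvg_ex[b /= Fb] := cvg_part _ ball_im.
apply/cvg_ex; exists (a +i* b : R[i]^o).
apply/cvgrPdist_lt => e e0.
have eE : e = (complex.Re e)%:C by rewrite RRe_real // gtr0_real.
have e2 : 0 < complex.Re e / 2 by rewrite divr_gt0 // -ltcR -eE.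
near=> z.
have za : `|a - complex.Re z| < complex.Re e / 2.
  by near: z; move/cvgrPdist_lt: Fa; apply.
have zb : `|b - complex.Im z| < complex.Re e / 2.
  by near: z; move/cvgrPdist_lt: Fb; apply.
rewrite eE; case: (z) za zb => c d /= za zb.
rewrite normc_def ltcR /= [complex.Re e]splitr.
apply: (le_lt_trans _ (ltrD za zb)).
rewrite -(@ler_pXn2r _ 2) ?nnegrE ?addr_ge0 ?sqrtr_ge0 //.
rewrite sqr_sqrtr ?addr_ge0 ?sqr_ge0 // [leRHS]sqrrD.
by rewrite !real_normK ?num_real // addrAC lerDl mulrn_wge0 // mulr_ge0.
Unshelve. all: by end_near. Qed.

Definition complex_line := R[i]^o.

HB.instance Definition _ := NormedModule.copy complex_line R[i]^o.
HB.instance Definition _ :=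
  Uniform_isComplete.Build complex_line complex_complete.

Definition complex_inner (x y : complex_line) : R[i] :=
  (x : R[i]) * (y : R[i])^*.

Lemma complex_inner_linear (a : R[i]) (x y z : complex_line) :
  complex_inner (a *: x + y) z = a * complex_inner x z + complex_inner y z.
Proof. by rewrite /complex_inner mulrDl mulrA. Qed.

Lemma complex_inner_conj (x y : complex_line) :
  complex_inner y x = (complex_inner x y)^*.
Proof.
rewrite /complex_inner (rmorphM (Num.conj : R[i] -> R[i]) (x : R[i])) /=.
by rewrite conjCK mulrC.
Qed.

Lemma complex_inner_norm (x : complex_line) : `|x| ^+ 2 = complex_inner x x.
Proof. exact: (normCK (x : R[i])). Qed.

HB.instance Definition _ := isHilbert.Build R complex_line
  complex_inner_linear complex_inner_conj complex_inner_norm.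

End ComplexHilbert.

Definition unitary_rep (R : realType) (G : groupType) (H : hilbertType R)
    (pi : G -> {linear H -> H}) : Prop :=
  [/\ forall xi, pi 1%g xi = xi,
      forall (x y : G) xi, pi (x * y)%g xi = pi x (pi y xi) &
      forall (x : G) (xi eta : H), inner (pi x xi) (pi x eta) = inner xi eta].

Section MaxNorm.
Variables (R : realType) (G : groupType).
Local Notation CG := (galg R G).

(* The operator pi(f) = \sum_x f(x) pi(x) on H. *)
Definition rep_eval (H : hilbertType R) (pi : G -> {linear H -> H}) (f : CG)
    (xi : H) : H := glift (fun x => pi x xi) f.

Definition rep_norms (f : CG) : set R :=
  [set r | exists (H : hilbertType R) (pi : G -> {linear H -> H}) (xi : H),
     [/\ unitary_rep pi, `|xi| <= 1 & r%:C = `|rep_eval pi f xi|]].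

(* The supremum of the operator norms of pi(f) over all unitary
   representations pi of G. *)
Definition max_norm (f : CG) : R := sup (rep_norms f).

Section Rep.
Variables (H : hilbertType R) (pi : G -> {linear H -> H}).
Hypothesis pi_unitary : unitary_rep pi.
Implicit Types (f h : CG) (xi eta : H).

Lemma unitary_rep_norm x xi : `|pi x xi| = `|xi|.
Proof.
have [_ _ piI] := pi_unitary.
by apply/eqP; rewrite -(@eqrXn2 _ 2) // !inner_norm piI.
Qed.

Lemma rep_eval_le f xi : `|xi| <= 1 ->
  `|rep_eval pi f xi| <= \sum_(x <- msupp f) `|f@_x|.
Proof.
move=> xi1; apply: le_trans (ler_norm_sum _ _ _) _; apply: ler_sum => x _.
by rewrite normrZ unitary_rep_norm ler_piMr.
Qed.

Lemma rep_eval_linear f : linear (rep_eval pi f).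
Proof.
move=> a xi eta; rewrite /rep_eval -gliftZ -gliftD.
by apply: eq_glift => x; rewrite linearP.
Qed.

Lemma rep_eval0 f : rep_eval pi f 0 = 0.
Proof.
have := rep_eval_linear f (- 1) 0 0.
by rewrite scaler0 addr0 scaleN1r addNr.
Qed.

Lemma rep_evalZ f (a : R[i]) xi : rep_eval pi f (a *: xi) = a *: rep_eval pi f xi.
Proof. by have := rep_eval_linear f a xi 0; rewrite rep_eval0 !addr0. Qed.

Lemma rep_eval1 xi : rep_eval pi 1 xi = xi.
Proof. by have [pi1 _ _] := pi_unitary; rewrite /rep_eval glift_delta pi1. Qed.

Lemma rep_eval_deltal x f xi : rep_eval pi (ltrans x f) xi = pi x (rep_eval pi f xi).
Proof.
have [_ piM _] := pi_unitary.
rewrite /rep_eval (glift_comp _ _ (@linearP _ _ _ _ (pi x))) /ltrans.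
rewrite (glift_comp _ _ (gliftP _)); apply: eq_glift => y /=.
by rewrite glift_delta piM.
Qed.

Lemma rep_evalM f h xi : rep_eval pi (f * h) xi = rep_eval pi f (rep_eval pi h xi).
Proof.
rewrite [f * h]galg_mulE {1}/rep_eval (glift_comp _ _ (gliftP _)).
by apply: eq_glift => x /=; exact: rep_eval_deltal.
Qed.

Lemma innerDl xi eta zeta : inner (xi + eta) zeta = inner xi zeta + inner eta zeta.
Proof. by rewrite -[xi]scale1r inner_linear mul1r scale1r. Qed.

Lemma inner0l xi : inner 0 xi = 0.
Proof. by apply: (addrI (inner 0 xi)); rewrite -innerDl !addr0. Qed.

Lemma innerZl a xi eta : inner (a *: xi) eta = a * inner xi eta.
Proof. by rewrite -[_ *: _]addr0 inner_linear inner0l addr0. Qed.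

Lemma innerDr xi eta zeta : inner zeta (xi + eta) = inner zeta xi + inner zeta eta.
Proof. by rewrite inner_conj innerDl rmorphD /= -!inner_conj. Qed.

Lemma innerZr a xi eta : inner eta (a *: xi) = a^* * inner eta xi.
Proof. by rewrite inner_conj innerZl rmorphM /= -inner_conj. Qed.

Lemma inner_suml (s : seq G) (F : G -> H) eta :
  inner (\sum_(x <- s) F x) eta = \sum_(x <- s) inner (F x) eta.
Proof.
elim: s => [|x s IHs]; first by rewrite !big_nil inner0l.
by rewrite !big_cons innerDl IHs.
Qed.

Lemma inner_sumr (s : seq G) (F : G -> H) eta :
  inner eta (\sum_(x <- s) F x) = \sum_(x <- s) inner eta (F x).
Proof.
by rewrite inner_conj inner_suml rmorph_sum /=; apply: eq_bigr => x _; rewrite -inner_conj.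
Qed.

Lemma rep_eval_star f xi eta :
  inner (rep_eval pi f xi) eta = inner xi (rep_eval pi f^^* eta).
Proof.
have [pi1 piM piI] := pi_unitary.
have -> : rep_eval pi f^^* eta = \sum_(x <- msupp f) (f@_x)^* *: pi x^-1%g eta.
  rewrite /rep_eval [f^^*]/(galg_star f) /galg_star linear_sum.
  by apply: eq_bigr => x _; rewrite linearZ /= glift_delta.
rewrite inner_suml inner_sumr; apply: eq_bigr => x _.
by rewrite innerZl innerZr conjCK -(piI x _ (pi x^-1%g eta)) -piM mulgV pi1.
Qed.

Lemma rep_eval_inner f xi : `|rep_eval pi f xi| ^+ 2 = inner xi (rep_eval pi (f^^* * f) xi).
Proof. by rewrite inner_norm rep_eval_star rep_evalM. Qed.

End Rep.

End MaxNorm.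

Section MaxNormTheory.
Variables (R : realType) (G : groupType).
Local Notation CG := (galg R G).
Implicit Types (f h : CG) (a : R[i]).

Definition trivial_rep (x : G) : {linear complex_line R -> complex_line R} :=
  idfun.

Lemma trivial_repP : unitary_rep trivial_rep.
Proof. by []. Qed.

Lemma rep_norms_neq0 f : rep_norms f !=set0.
Proof.
exists 0, (complex_line R), trivial_rep, 0; split; first exact: trivial_repP.
  by rewrite normr0.
by rewrite rep_eval0 normr0.
Qed.

Lemma rep_norms_ub f : has_ubound (rep_norms f).
Proof.
exists (complex.Re (\sum_(x <- msupp f) `|f@_x|)) => r [H [pi [xi [piU xi1 rE]]]].
rewrite -lecR rE (le_trans (rep_eval_le piU f xi1)) //.
rewrite RRe_real // ger0_real // sumr_ge0 //.
Qed.

Lemma max_norm_unit f (H : hilbertType R) (pi : G -> {linear H -> H}) (xi : H) :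
  unitary_rep pi -> `|xi| <= 1 -> `|rep_eval pi f xi| <= (max_norm f)%:C.
Proof.
move=> piU xi1; set n := `|_|.
have nE : (complex.Re n)%:C = n by rewrite RRe_real // ger0_real /n // normr_ge0.
rewrite -nE lecR; apply: (ub_le_sup (rep_norms_ub f)).
by exists H, pi, xi; split.
Qed.

Lemma max_norm_le f (M : R) :
  (forall (H : hilbertType R) (pi : G -> {linear H -> H}) (xi : H),
    unitary_rep pi -> `|xi| <= 1 -> `|rep_eval pi f xi| <= M%:C) ->
  max_norm f <= M.
Proof.
move=> fM; apply: ge_sup; first exact: rep_norms_neq0.
by move=> r [H [pi [xi [piU xi1 rE]]]]; rewrite -lecR rE fM.
Qed.

Lemma max_norm_ge0 f : 0 <= max_norm f.
Proof.
rewrite -lecR.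
apply: le_trans (max_norm_unit (xi := 0) f trivial_repP _); last by rewrite normr0.
exact: normr_ge0.
Qed.

Lemma max_norm_rep f (H : hilbertType R) (pi : G -> {linear H -> H}) (xi : H) :
  unitary_rep pi -> `|rep_eval pi f xi| <= (max_norm f)%:C * `|xi|.
Proof.
move=> piU; have [->|xi0] := eqVneq xi 0; first by rewrite rep_eval0 !normr0 mulr0.
have xin0 : 0 < `|xi| by rewrite normr_gt0.
rewrite -ler_pdivrMr //.
have := @max_norm_unit f H pi (`|xi|^-1 *: xi) piU.
rewrite rep_evalZ !normrZ normfV normr_id mulVf ?gt_eqF // mulrC; exact.
Qed.

Lemma max_normD f h : max_norm (f + h) <= max_norm f + max_norm h.
Proof.
apply: max_norm_le => H pi xi piU xi1; rewrite /rep_eval linearD rmorphD /=.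
by apply: le_trans (ler_normD _ _) _; apply: lerD; exact: max_norm_unit.
Qed.

Lemma max_normZ_le a f : (max_norm (a *: f))%:C <= `|a| * (max_norm f)%:C.
Proof.
rewrite normc_re -rmorphM lecR.
apply: max_norm_le => H pi xi piU xi1; rewrite /rep_eval linearZ normrZ rmorphM /=.
by rewrite -normc_re ler_wpM2l //; exact: max_norm_unit.
Qed.

Lemma max_normZ a f : (max_norm (a *: f))%:C = `|a| * (max_norm f)%:C.
Proof.
apply/le_anti; rewrite max_normZ_le /=.
have [->|a0] := eqVneq a 0.
  by rewrite normr0 mul0r lecR max_norm_ge0.
rewrite -ler_pdivlMl ?normr_gt0 // -normfV.
rewrite -[f in leLHS](scale1r f) -(mulVf a0) -scalerA.
exact: max_normZ_le.
Qed.

Lemma max_normM f h : max_norm (f * h) <= max_norm f * max_norm h.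
Proof.
apply: max_norm_le => H pi xi piU xi1; rewrite rep_evalM // rmorphM /=.
apply: le_trans (max_norm_rep _ _ piU) _.
by rewrite ler_wpM2l ?lecR ?max_norm_ge0 // max_norm_unit.
Qed.

Lemma conjc_real (r : R) : (r%:C)^* = r%:C :> R[i].
Proof. by apply: conj_Creal; rewrite complex_real. Qed.

Lemma inner_le (H : hilbertType R) (xi eta : H) (p s : R) : 0 <= s ->
  `|xi| <= 1 -> `|eta| <= s%:C -> inner xi eta = p%:C -> p <= s.
Proof.
rewrite le_eqVlt => /predU1P[<-|s0] xi1 etas pE.
  move: etas; rewrite normr_le0 => /eqP eta0; move: pE; rewrite eta0.
  by rewrite inner_conj inner0l rmorph0 => /(@complexI R)<-.
have pE' : inner eta xi = p%:C.
  by rewrite inner_conj pE conjc_real.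
have : 0 <= `|s%:C *: xi - eta| ^+ 2 by rewrite exprn_ge0.
rewrite inner_norm innerDl !innerDr -scaleN1r !innerZl !innerZr pE pE'.
rewrite -!inner_norm.
rewrite rmorphN1 conjc_real => ge0.
have : (s * p + s * p)%:C <= (s * s + s * s)%:C :> R[i].
  rewrite !rmorphD !rmorphM /=.
  apply: (@le_trans _ _ (s%:C * (s%:C * `|xi| ^+ 2) + `|eta| ^+ 2)).
    rewrite -subr_ge0; apply: le_trans ge0 _.
    rewrite le_eqVlt; apply/orP; left; apply/eqP.
    move: (s%:C) (p%:C) (`|xi|) (`|eta|) => t q u v; ring.
  apply: lerD; last by rewrite expr2 ler_pM.
  by rewrite mulrA ler_piMr ?mulr_ge0 ?lecR ?(ltW s0) // expr_le1.
by rewrite lecR -!mulr2n lerMn2r /= ler_pM2l.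
Qed.

Lemma max_norm_sqr f : max_norm f ^+ 2 <= max_norm (f^^* * f).
Proof.
set M := max_norm (f^^* * f).
have M0 : 0 <= M by exact: max_norm_ge0.
rewrite -(sqr_sqrtr M0) ler_pXn2r ?nnegrE ?max_norm_ge0 ?sqrtr_ge0 //.
apply: max_norm_le => H pi xi piU xi1.
rewrite -(@ler_pXn2r _ 2) ?nnegrE ?lecR ?sqrtr_ge0 //.
rewrite -rmorphXn /= (sqr_sqrtr M0).
have pE : `|rep_eval pi f xi| ^+ 2 =
    (complex.Re (`|rep_eval pi f xi| ^+ 2))%:C.
  by rewrite RRe_real // ger0_real // exprn_ge0.
rewrite pE lecR; apply: (@inner_le H xi (rep_eval pi (f^^* * f) xi)) => //.
  exact: max_norm_unit.
by rewrite -(rep_eval_inner piU).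
Qed.

Lemma max_norm_star_le f : max_norm f <= max_norm f^^*.
Proof.
have [->|f0] := eqVneq (max_norm f) 0; first exact: max_norm_ge0.
have := le_trans (max_norm_sqr f) (max_normM _ _).
by rewrite expr2 ler_pM2r // lt0r f0 max_norm_ge0.
Qed.

Lemma max_norm_star_mul f : max_norm (f^^* * f) = max_norm f ^+ 2.
Proof.
apply/le_anti; rewrite max_norm_sqr andbT (le_trans (max_normM _ _)) //.
rewrite expr2 ler_wpM2r ?max_norm_ge0 //.
by rewrite -[f in leRHS]starK max_norm_star_le.
Qed.

Lemma max_norm1_neq0 : max_norm (1 : CG) != 0.
Proof.
have xi1 : `|1 : complex_line R| <= 1 by rewrite normr1.
have := max_norm_unit (1 : CG) trivial_repP xi1.
rewrite rep_eval1 // normr1 => le1.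
by apply/eqP => n0; move: le1; rewrite n0 ler10.
Qed.

HB.instance Definition _ := hasCStarSeminorm.Build R (galg R G)
  max_normD max_normZ max_normM max_norm_star_mul max_norm1_neq0.

End MaxNormTheory.

Definition full_cstar (R : realType) (G : groupType) : cstarAlgType R :=
  completion (galg R G).

(* The restricted wreath product: pairs (a, t) with a : Gamma -> Lambda finitely
   supported and t in Gamma, Gamma acting by (t.a)(x) = a(t^-1 x). *)
Section Wreath.
Variables (Lambda Gamma : groupType).
Local Open Scope group_scope.

Record wreath := Wreath {
  wbase : {fsfun Gamma -> Lambda with 1};
  wtop : Gamma
}.

HB.instance Definition _ := gen_eqMixin wreath.
HB.instance Definition _ := gen_choiceMixin wreath.

Implicit Types (g h k : wreath) (t x : Gamma).

Lemma wreath_eq g h : wbase g =1 wbase h -> wtop g = wtop h -> g = h.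
Proof. by case: g h => [a t] [b s] /= /fsfunP-> ->. Qed.

Definition wreath_one := Wreath [fsfun] 1.

Definition wreath_mul g h := Wreath
  [fsfun x in finsupp (wbase g) `|` [fset wtop g * y | y in finsupp (wbase h)]
     => wbase g x * wbase h ((wtop g)^-1 * x)]%fset
  (wtop g * wtop h).

Definition wreath_inv g := Wreath
  [fsfun x in [fset (wtop g)^-1 * y | y in finsupp (wbase g)]
     => (wbase g (wtop g * x))^-1]%fset
  (wtop g)^-1.

Lemma wreath_mulE g h x :
  wbase (wreath_mul g h) x = wbase g x * wbase h ((wtop g)^-1 * x).
Proof.
rewrite fsfun_fun; case: ifPn => //; rewrite inE negb_or => /andP[gx hx].
rewrite (fsfun_dflt gx) mul1g [RHS]fsfun_dflt //.
apply: contra hx => hx; apply/imfsetP; exists ((wtop g)^-1 * x) => //.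
by rewrite mulVKg.
Qed.

Lemma wreath_invE g x : wbase (wreath_inv g) x = (wbase g (wtop g * x))^-1.
Proof.
rewrite fsfun_fun; case: ifPn => // gx.
rewrite [wbase g _]fsfun_dflt ?invg1 //.
apply: contra gx => gx; apply/imfsetP; exists (wtop g * x) => //.
by rewrite mulKg.
Qed.

Lemma wreath_oneE x : wbase wreath_one x = 1.
Proof. by rewrite fsfun0E. Qed.

Lemma wreath_mulA : associative wreath_mul.
Proof.
move=> g h k; apply: wreath_eq => [x|/=]; last by rewrite mulgA.
by rewrite !wreath_mulE /= invgM !mulgA.
Qed.

Lemma wreath_mul1l : left_id wreath_one wreath_mul.
Proof.
move=> g; apply: wreath_eq => [x|/=]; last by rewrite mul1g.
by rewrite wreath_mulE wreath_oneE /= invg1 !mul1g.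
Qed.

Lemma wreath_mul1r : right_id wreath_one wreath_mul.
Proof.
move=> g; apply: wreath_eq => [x|/=]; last by rewrite mulg1.
by rewrite wreath_mulE wreath_oneE mulg1.
Qed.

Lemma wreath_mulV : left_inverse wreath_one wreath_inv wreath_mul.
Proof.
move=> g; apply: wreath_eq => [x|/=]; last by rewrite mulVg.
by rewrite wreath_mulE wreath_invE wreath_oneE /= invgK mulVg.
Qed.

Lemma wreath_mulrV : right_inverse wreath_one wreath_inv wreath_mul.
Proof.
move=> g; apply: wreath_eq => [x|/=]; last by rewrite mulgV.
by rewrite wreath_mulE wreath_invE wreath_oneE mulVKg mulgV.
Qed.

HB.instance Definition _ := isGroup.Build wreath
  wreath_mulA wreath_mul1l wreath_mul1r wreath_mulV wreath_mulrV.

End Wreath.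

Definition non_torsion (G : groupType) : Prop :=
  exists x : G, forall n : nat, (0 < n)%N -> (x ^+ n)%g <> 1%g.

Definition unitary_mxrep (R : realType) (G : groupType) (d : nat)
    (rho : G -> 'M[R[i]]_d) : Prop :=
  (forall x, rho x \is unitarymx) /\
  (forall x y : G, rho (x * y)%g = rho x *m rho y).

Definition has_nontrivial_fin_dim_rep (R : realType) (G : groupType) : Prop :=
  exists (d : nat) (rho : G -> 'M[R[i]]_d),
    [/\ (1 <= d)%N, unitary_mxrep rho & exists x, rho x <> 1%:M].

Definition has_nontrivial_finite_class (G : groupType) : Prop :=
  exists c : G, c <> 1%g /\ finite_set [set (c ^ x)%g | x in [set: G]].

(* Main.v *)
(* Let t in Gamma have infinite order and S = {t^-n : n >= 0}, so that S t^-1 is a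
   proper subset of S.  Each hypothesis on Lambda gives a positive definite psi on
   Lambda and q in C[Lambda] such that q acts as 1 in the representation given by
   psi and as 0 in the trivial one.  The function g = (a, x) |-> prod_(r in S) psi (a r)
   if x = 1, and 0 otherwise, is positive definite on the wreath product; in its GNS
   representation the copy p of q at the site 1 is the projection on the translates
   x with x^-1 in S, and conjugation by u = (1, t) sends it to a proper
   subprojection.  Hence u p + 1 - p is a non-unitary isometry modulo the ideal of
   the elements that vanish in this representation.  *)
From HB Require Import structures.
Require Import Defs.
From mathcomp Require Import all_boot all_order all_algebra.
From mathcomp Require Import finmap complex monalg.
From mathcomp Require Import all_classical all_reals topology normedtype sequences.
From mathcomp Require Import ring.

Set Implicit Arguments.
Unset Strict Implicit.
Unset Printing Implicit Defensive.

Import Order.TTheory GRing.Theory Num.Theory.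
Import numFieldNormedType.Exports.

Local Open Scope classical_set_scope.
Local Open Scope complex_scope.
Local Open Scope ring_scope.
Local Open Scope quotient_scope.

(** * Semi-inner products and the Cauchy-Schwarz inequality *)

Section SemiInner.
Variables (R : realType).
Local Notation C := R[i].

(** The positive definite function on the wreath product is induced from the base group: there it is
    the product state with [psi] at the sites of S and the trivial state elsewhere. Translation by a
    group element with top x moves site 1 to x^-1, so the same [p] acts as 1 on some cosets of the
    base group and as 0 on the others, although it need not be a projection in the group algebra.
    For this reason every operator identity is tested on matrix coefficients of the state.

    The obstacle is analytic. The maximal norm is a supremum over representations on complete
    spaces, so the state extends to the full C*-algebra only once the GNS space has been built as a
    genuine Hilbert space; this occupies the opening sections.

    For a finite class of c, there are two cases. If c is not central, conjugation permutes its
    class and gives a non-trivial finite dimensional representation. If c is central, a non-trivial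
    character of the subgroup generated by c, extended by 0, serves as [psi]. *)

Record semiInner (V : lmodType C) := SemiInner {
  form :> V -> V -> C;
  form_linear : forall a x y z, form (a *: x + y) z = a * form x z + form y z;
  form_conj : forall x y, form y x = (form x y)^*;
  form_ge0 : forall x, 0 <= form x x
}.

Variables (V : lmodType C) (B : semiInner V).
Implicit Types x y z : V.

Lemma formDl x y z : B (x + y) z = B x z + B y z.
Proof. by rewrite -[x]scale1r form_linear mul1r scale1r. Qed.

Lemma form0l z : B 0 z = 0.
Proof. by apply: (addrI (B 0 z)); rewrite -formDl !addr0. Qed.

Lemma formZl a x z : B (a *: x) z = a * B x z.
Proof. by rewrite -[_ *: _]addr0 form_linear form0l addr0. Qed.

Lemma formNl x z : B (- x) z = - B x z.
Proof. by rewrite -scaleN1r formZl mulN1r. Qed.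

Lemma formBl x y z : B (x - y) z = B x z - B y z.
Proof. by rewrite formDl formNl. Qed.

Lemma formDr x y z : B z (x + y) = B z x + B z y.
Proof. by rewrite form_conj formDl rmorphD /= -!form_conj. Qed.

Lemma formZr a x z : B z (a *: x) = a^* * B z x.
Proof. by rewrite form_conj formZl rmorphM /= -form_conj. Qed.

Definition snorm x : C := sqrtC (B x x).

Lemma snorm_ge0 x : 0 <= snorm x.
Proof. by rewrite sqrtC_ge0 form_ge0. Qed.

Lemma snorm_sqr x : snorm x ^+ 2 = B x x.
Proof. exact: sqrtCK. Qed.

Lemma form_sqr_le x y : `|B x y| ^+ 2 <= B x x * B y y.
Proof.
set p := `|B x y| ^+ 2.
have p0 : 0 <= p by rewrite exprn_ge0.
have pE : p = B x y * B y x by rewrite /p normCK -form_conj.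
have key (s : C) : 0 <= s -> 0 <= B x x - (s * p) *+ 2 + s ^+ 2 * p * B y y.
  move=> s0; have := form_ge0 B (x - (s * B x y) *: y).
  rewrite -scaleNr !(formDl, formDr, formZl, formZr) rmorphN rmorphM /=.
  rewrite (conj_Creal (ger0_real s0)) -form_conj pE.
  by congr (0 <= _); ring.
(* The form may be degenerate. For a null vector [y] the bound [key] is affine in [s], and at
   [(B x x + 1) / p] it would be negative; otherwise the minimum over [s] is at [(B y y)^-1]. *)
have [y0|y0] := eqVneq (B y y) 0.
  rewrite y0 mulr0; have [->//|pn0] := eqVneq p 0.
  have xx := form_ge0 B x; have xx1 : 0 <= B x x + 1 by rewrite addr_ge0.
  have := key _ (divr_ge0 xx1 p0); rewrite divfK // y0 mulr0 addr0.
  rewrite (_ : _ - _ = - (B x x + 1 + 1)); last by ring.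
  by rewrite oppr_ge0 => /(lt_le_trans (ltr_wpDl xx1 ltr01)); rewrite ltxx.
have yy0 : 0 < B y y by rewrite lt0r y0 form_ge0.
have := key (B y y)^-1; rewrite invr_ge0 ltW // => /(_ isT).
rewrite (_ : _ + _ = B x x - p / B y y); last by field.
by rewrite subr_ge0 ler_pdivrMr.
Qed.

Lemma form_le x y : `|B x y| <= snorm x * snorm y.
Proof.
rewrite -(@ler_pXn2r _ 2) ?nnegrE ?mulr_ge0 ?snorm_ge0 //.
by rewrite exprMn !snorm_sqr form_sqr_le.
Qed.

Lemma snormD x y : snorm (x + y) <= snorm x + snorm y.
Proof.
rewrite -(@ler_pXn2r _ 2) ?nnegrE ?addr_ge0 ?snorm_ge0 //.
rewrite sqrrD !snorm_sqr !(formDl, formDr) [B y x]form_conj.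
rewrite addrA [leLHS](_ : _ = B x x + (B x y + (B x y)^*) + B y y); last by ring.
rewrite lerD2r lerD2l (le_trans (real_ler_norm _)) //.
  by rewrite addrC CrealE rmorphD /= conjCK addrC.
by rewrite (le_trans (ler_normD _ _)) // norm_conjC -mulr2n lerMn2r form_le orbT.
Qed.

Lemma snormZ a x : snorm (a *: x) = `|a| * snorm x.
Proof.
rewrite /snorm formZl formZr mulrA -normCK sqrtCM ?exprn_ge0 ?form_ge0 //.
  by rewrite sqrCK.
all: by rewrite ?nnegrE ?exprn_ge0 ?form_ge0.
Qed.

End SemiInner.

(** * Epsilon arguments in the complex numbers *)

Lemma complex_archi (R : realType) (e : R[i]) : 0 < e ->
  exists n, n.+1%:R^-1 < e.
Proof.
move=> e0; have eE : e = (complex.Re e)%:C by rewrite RRe_real // gtr0_real.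
have e0' : 0 < complex.Re e by rewrite -ltcR -eE.
have /cvgrPdist_lt/(_ _ e0')[N _ PN] := @cvg_harmonic R.
exists N; have := PN N (leqnn N).
rewrite /= sub0r normrN ger0_norm ?invr_ge0 ?ler0n //.
rewrite -ltcR -eE; apply: le_lt_trans.
by rewrite fmorphV rmorph_nat.
Qed.

Lemma complex_le_eps (R : realType) (x y : R[i]) : 0 <= x -> 0 <= y ->
  (forall e, 0 < e -> x <= y + e) -> x <= y.
Proof.
move=> x0 y0 xy.
have xE : x = (complex.Re x)%:C by rewrite RRe_real // ger0_real.
have yE : y = (complex.Re y)%:C by rewrite RRe_real // ger0_real.
rewrite xE yE lecR; apply/ler_addgt0Pr => e e0.
by rewrite -lecR rmorphD /= -xE -yE xy // ltcR.
Qed.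

Lemma complex_eq0_eps (R : realType) (x : R[i]) :
  (forall e, 0 < e -> `|x| <= e) -> x = 0.
Proof.
move=> xe; apply/eqP; rewrite -normr_le0; apply: complex_le_eps => // e e0.
by rewrite add0r xe.
Qed.

Lemma complex_ge0_eps (R : realType) (x : R[i]) :
  (forall e, 0 < e -> exists2 y, 0 <= y & `|x - y| <= e) -> 0 <= x.
Proof.
move=> xe; apply: (@le_trans _ _ `|x|) => //.
suff -> : `|x| = x by [].
apply/eqP; rewrite -subr_eq0; apply/eqP/complex_eq0_eps => e e0.
have [|y y0 xy] := xe (e / 2); first by rewrite divr_gt0.
rewrite -(subrKA y) (le_trans (ler_normD _ _)) // [e]splitr lerD //.
  by rewrite (le_trans _ xy) // (le_trans _ (ler_dist_dist x y)) // (ger0_norm y0).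
by rewrite distrC.
Qed.

(* The completion of [V] is realised inside the functions [V -> C]: the vector
   [v] becomes [B v], and the limits are taken for the norm of bounded
   functionals. *)
Section Completion.
Variables (R : realType) (V : lmodType R[i]) (B : semiInner V).
Local Notation C := R[i].
Local Notation N := (snorm B).
Implicit Types (F G : V -> complex_line R) (v w x : V).

Definition close F v (a : C) : Prop := forall x, `|(F x : C) - B v x| <= a * N x.

Definition approx : {pred V -> complex_line R} :=
  [pred F | `[< forall e : C, 0 < e -> exists v, close F v e >]].

Lemma approxP F :
  reflect (forall e : C, 0 < e -> exists v, close F v e) (F \in approx).
Proof. exact: asboolP. Qed.

Lemma close_form v a : 0 <= a -> close (B v : V -> complex_line R) v a.
Proof. by move=> a0 x; rewrite subrr normr0 mulr_ge0 ?snorm_ge0. Qed.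

Lemma close_linear (c : C) F G v w a b : close F v a -> close G w b ->
  close (c *: F + G) (c *: v + w) (`|c| * a + b).
Proof.
move=> Fv Gw x; rewrite form_linear.
rewrite [X in `|X|](_ : _ = c * ((F x : C) - B v x) + ((G x : C) - B w x)).
  rewrite (le_trans (ler_normD _ _)) // mulrDl lerD // normrM -mulrA.
  by rewrite ler_wpM2l.
by rewrite mulrBr addrACA opprD.
Qed.

Lemma close_le F v a b : a <= b -> close F v a -> close F v b.
Proof.
by move=> ab Fv x; rewrite (le_trans (Fv x)) // ler_wpM2r ?snorm_ge0.
Qed.

Lemma approx_submod : submod_closed approx.
Proof.
split.
  apply/approxP => e e0; exists 0 => x.
  by rewrite form0l subr0 normr0 mulr_ge0 ?snorm_ge0 ?ltW.
move=> c F G /approxP Fa /approxP Ga; apply/approxP => e e0.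
have c1 : 0 < `|c| + 1 by rewrite ltr_wpDl.
have [|v Fv] := Fa (e / (`|c| + 1) / 2); first by rewrite !divr_gt0.
have [|w Gw] := Ga (e / 2); first by rewrite divr_gt0.
exists (c *: v + w); apply: close_le (close_linear c Fv Gw).
rewrite mulrA [leRHS]splitr lerD2r ler_pM2r ?invr_gt0 //.
by rewrite mulrCA ler_piMr ?ltW // ltr_pdivrMr // mul1r ltrDl.
Qed.

HB.instance Definition _ :=
  GRing.isSubmodClosed.Build C (V -> complex_line R) approx approx_submod.

Record hcompl := HCompl { hfun :> V -> complex_line R; hfunP : hfun \in approx }.

HB.instance Definition _ := [isSub for hfun].
HB.instance Definition _ := [Choice of hcompl by <:].
HB.instance Definition _ := [SubChoice_isSubLmodule of hcompl by <:].

End Completion.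

(** * The inner product of the completion, and its completeness *)

Section CompletionInner.
Variables (R : realType) (V : lmodType R[i]) (B : semiInner V).
Local Notation C := R[i].
Local Notation N := (snorm B).
Local Notation H := (hcompl B).
Implicit Types (F G : H) (v w x y : V).

Definition bounded_by F (M : C) : Prop := forall x, `|F x : C| <= M * N x.

Lemma bounded_close F v (a : C) : close B F v a -> bounded_by F (N v + a).
Proof.
move=> Fv x; rewrite -[F x](subrK (B v x)) (le_trans (ler_normD _ _)) //.
by rewrite mulrDl addrC lerD // form_le.
Qed.

Lemma hcompl_bounded F : exists2 M : C, 0 <= M & bounded_by F M.
Proof.
have /approxP/(_ 1 ltr01)[v Fv] := hfunP F.
by exists (N v + 1); [rewrite addr_ge0 ?snorm_ge0|exact: bounded_close].
Qed.

Lemma close_dist F v w (a b : C) : 0 <= a -> 0 <= b ->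
  close B F v a -> close B F w b -> N (v - w) <= a + b.
Proof.
move=> a0 b0 Fv Fw; have [->|vw] := eqVneq (N (v - w)) 0; first by rewrite addr_ge0.
rewrite -(@ler_pM2r _ (N (v - w))) ?lt0r ?vw ?snorm_ge0 // -expr2 snorm_sqr.
rewrite -[leLHS]ger0_norm ?form_ge0 //.
rewrite [X in `|X|](formBl B v w (v - w)) -(subrKA (F (v - w) : C)).
rewrite (le_trans (ler_normD _ _)) // mulrDl lerD //.
by rewrite distrC.
Qed.

Lemma hcomplB F x y : F (x - y) = (F x : C) - F y :> C.
Proof.
apply/eqP; rewrite -subr_eq0; apply/eqP/complex_eq0_eps => e e0.
(* The last 1 keeps [S] positive when all three vectors are null. *)
pose S := N (x - y) + (N x + N y) + 1.
have S0 : 0 < S by rewrite ltr_wpDl // !addr_ge0 ?snorm_ge0.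
have /approxP/(_ _ (divr_gt0 e0 S0))[v Fv] := hfunP F.
rewrite (_ : _ - _ = (F (x - y) - B v (x - y)) - ((F x - B v x) - (F y - B v y))); last first.
  have -> : B v (x - y) = B v x - B v y.
    by rewrite form_conj formBl rmorphB /= -!form_conj.
  by move: (F (x - y)) (F x) (F y) (B v x) (B v y) => a b c d f; ring.
apply: (@le_trans _ _ (e / S * (S - 1))); last first.
  by rewrite mulrBr divfK ?gt_eqF // lerBlDr lerDl mulr1 ltW // divr_gt0.
rewrite addrK (le_trans (ler_normB _ _)) // mulrDr lerD //.
by rewrite (le_trans (ler_normB _ _)) // mulrDr lerD.
Qed.

Lemma close_app F n : exists v, close B F v (n.+1%:R^-1).
Proof. by have /approxP := hfunP F; apply; rewrite invr_gt0 ltr0n. Qed.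

Definition happ F n : V := sval (cid (close_app F n)).

Lemma happP F n : close B F (happ F n) (n.+1%:R^-1).
Proof. exact: svalP (cid (close_app F n)). Qed.

(** The value [F v] plays the part of the product of [F] with the vector [v], so [F] is evaluated
    along approximants of [G]. *)
Definition hinner F G : C := lim (((fun n => F (happ G n)) : nat -> complex_line R) @ \oo).

Lemma eps_split (M e : C) : 0 <= M -> 0 < e -> exists2 d, 0 < d & M * d <= e.
Proof.
move=> M0 e0; exists (e / (M + 1)); first by rewrite divr_gt0 // ltr_wpDl.
by rewrite mulrCA ler_piMr ?ltW // ltr_pdivrMr ?ltr_wpDl // mul1r ltrDl ltr01.
Qed.

(** Two approximants of [G] differ by at most the sum of their errors, so a bounded [F] is Cauchy
    along them. The bound holds for any [w], so the choice made in [happ] does not affect the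
    limit. *)
Lemma hinner_app F G w (b M : C) : 0 <= M -> 0 <= b -> bounded_by F M -> close B G w b ->
  `|hinner F G - F w| <= M * b.
Proof.
move=> M0 b0 FM Gw; set u : nat -> complex_line R := fun n => F (happ G n).
have i0 n : 0 <= n.+1%:R^-1 :> C by rewrite invr_ge0 ler0n.
have uw n v c : 0 <= c -> close B G v c ->
    `|(u n : C) - F v| <= M * (n.+1%:R^-1 + c).
  move=> c0 Gv; rewrite -hcomplB (le_trans (FM _)) // ler_wpM2l //.
  by apply: close_dist => //; exact: happP.
have /cvgrPdist_le ucvg : u @ \oo --> (hinner F G : complex_line R).
  apply: cauchy_cvg; apply: cauchy_exP => e e0.
  have e2 : 0 < e / 2 by rewrite divr_gt0.
  have [d d0 Md] := eps_split M0 (divr_gt0 e2 (ltr0n _ 2)).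
  have [n nd] := complex_archi d0; exists (u n); exists n => // k /= nk.
  rewrite -ball_normE /= distrC; apply: (le_lt_trans (uw k _ _ (i0 n) (happP G n))).
  apply: (@le_lt_trans _ _ (e / 2)); last by rewrite ltr_pdivrMr // ltr_pMr // ltr1n.
  rewrite mulrDr [leRHS]splitr lerD // (le_trans _ Md) // ler_wpM2l //.
    by rewrite (le_trans _ (ltW nd)) // lef_pV2 ?posrE ?ltr0n // ler_nat.
  exact: ltW.
apply: complex_le_eps; rewrite ?mulr_ge0 // => e e0.
have [d d0 Md] := eps_split M0 (divr_gt0 e0 (ltr0n _ 2)).
have [m md] := complex_archi d0.
have [k _ kP] := ucvg _ (divr_gt0 e0 (ltr0n _ 2)).
have /= := kP (maxn m k) (leq_maxr _ _).
set j := maxn m k => uj.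
rewrite -(subrKA (u j : C)) (le_trans (ler_normD _ _)) //.
rewrite [e]splitr [leRHS]addrCA lerD // (le_trans (uw _ _ _ b0 Gw)) // mulrDr [leLHS]addrC lerD2l.
rewrite (le_trans _ Md) // ler_wpM2l // (le_trans _ (ltW md)) //.
by rewrite lef_pV2 ?posrE ?ltr0n // ler_nat ltnS leq_maxl.
Qed.

Lemma close_norm F v (a M : C) : 0 <= a -> 0 <= M -> bounded_by F M ->
  close B F v a -> N v <= M + a.
Proof.
move=> a0 M0 FM Fv; have [->|v0] := eqVneq (N v) 0; first by rewrite addr_ge0.
rewrite -(@ler_pM2r _ (N v)) ?lt0r ?v0 ?snorm_ge0 // -expr2 snorm_sqr.
rewrite -[leLHS]ger0_norm ?form_ge0 // -[X in `|X|](subrK (F v : C)).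
rewrite addrC (le_trans (ler_normD _ _)) // mulrDl lerD //.
by rewrite distrC.
Qed.

Lemma hinner_form F G (e : C) : 0 < e -> exists2 d, 0 < d &
  forall v w, close B F v d -> close B G w d -> `|hinner F G - B v w| <= e.
Proof.
move=> e0; have [M M0 FM] := hcompl_bounded F; have [K K0 GK] := hcompl_bounded G.
(* With [d = e / S], the summand [e] forces [d <= 1], hence [N w <= K + 1], and the total error is
   at most [d * (M + K + 1)]. *)
pose S := M + K + 1 + e; have S0 : 0 < S by rewrite !ltr_wpDl ?addr_ge0.
have d0 : 0 < e / S by rewrite divr_gt0.
have d1 : e / S <= 1 by rewrite ler_pdivrMr // mul1r lerDr !addr_ge0.
exists (e / S) => // v w; set d := e / S in d0 d1 *.
move=> Fv Gw; rewrite -(subrKA (F w : C)) (le_trans (ler_normD _ _)) //.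
have Fw : `|hinner F G - F w| <= M * d by apply: hinner_app => //; exact: ltW.
rewrite (le_trans (lerD Fw (Fv w))) // (@le_trans _ _ (d * S)) //; last first.
  by rewrite /d divfK // gt_eqF.
rewrite mulrC -mulrDr ler_wpM2l ?(ltW d0) //.
rewrite [X in _ <= X](_ : S = M + (K + (1 + e))); last by rewrite /S; ring.
rewrite lerD2l.
rewrite (le_trans (close_norm (ltW d0) K0 GK Gw)) // lerD2l.
by rewrite (le_trans d1) // lerDl ltW.
Qed.

Lemma hinner_linear (a : C) F G K :
  hinner (a *: F + G) K = a * hinner F K + hinner G K.
Proof.
apply/eqP; rewrite -subr_eq0; apply/eqP/complex_eq0_eps => e e0.
have [M1 M10 FM] := hcompl_bounded F; have [M2 M20 GM] := hcompl_bounded G.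
have [M3 M30 SM] := hcompl_bounded (a *: F + G).
have [|d d0 Md] := @eps_split (M3 + (`|a| * M1 + M2)) e _ e0.
  by rewrite !addr_ge0 ?mulr_ge0.
have /approxP/(_ _ d0)[w Kw] := hfunP K.
rewrite (le_trans _ Md) // mulrDl mulrDl -mulrA.
rewrite -(subrKA ((a *: F + G) w : C)) (le_trans (ler_normD _ _)) // lerD //.
  by apply: hinner_app => //; exact: ltW.
rewrite [X in `|X|](_ : _ = - (a * (hinner F K - F w) + (hinner G K - G w))).
  rewrite normrN (le_trans (ler_normD _ _)) // lerD // ?normrM.
    by rewrite ler_wpM2l //; apply: hinner_app => //; exact: ltW.
  by apply: hinner_app => //; exact: ltW.
rewrite [(a *: F + G) w](_ : _ = a * F w + G w :> C) //.
by move: (hinner _ _) (hinner _ _) (F w : C) (G w : C) => p q r s; ring.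
Qed.

(** The number [d1 * d2 / (d1 + d2)] lies below both tolerances and replaces their minimum. *)
Lemma close_pair F (d1 d2 : C) : 0 < d1 -> 0 < d2 ->
  exists2 v, close B F v d1 & close B F v d2.
Proof.
move=> d10 d20; have d12 : 0 < d1 + d2 by rewrite addr_gt0.
have /approxP/(_ (d1 * d2 / (d1 + d2)))[] := hfunP F.
  by rewrite divr_gt0 // mulr_gt0.
move=> v Fv; exists v; apply: close_le Fv; rewrite ler_pdivrMr // ?ler_pM2l //.
  by rewrite lerDr ltW.
by rewrite mulrC ler_pM2l // lerDl ltW.
Qed.

Lemma hinner_conj F G : hinner G F = (hinner F G)^*.
Proof.
apply/eqP; rewrite -subr_eq0; apply/eqP/complex_eq0_eps => e e0.
have e2 : 0 < e / 2 by rewrite divr_gt0.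
have [d1 d10 FG] := hinner_form F G e2; have [d2 d20 GF] := hinner_form G F e2.
have [v Fv1 Fv2] := close_pair F d10 d20; have [w Gw1 Gw2] := close_pair G d10 d20.
rewrite -(subrKA (B w v)) (le_trans (ler_normD _ _)) // [e]splitr lerD //.
  exact: GF.
by rewrite form_conj -rmorphB norm_conjC distrC FG.
Qed.

Lemma hinner_ge0 F : 0 <= hinner F F.
Proof.
apply: complex_ge0_eps => e e0; have [d d0 FF] := hinner_form F F e0.
have /approxP/(_ _ d0)[v Fv] := hfunP F.
by exists (B v v); [exact: form_ge0|exact: FF].
Qed.

Definition hsemi : semiInner H := SemiInner hinner_linear hinner_conj hinner_ge0.

Lemma iota_approx v : (B v : V -> complex_line R) \in approx B.
Proof. by apply/approxP => e e0; exists v; apply: close_form; exact: ltW. Qed.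

Definition iota v : H := HCompl (iota_approx v).

(** Reproducing property: [w] approximates [iota w] with error 0. *)
Lemma hinner_iota F w : hinner F (iota w) = F w.
Proof.
have [M M0 FM] := hcompl_bounded F.
apply/eqP; rewrite -subr_eq0 -normr_le0 -(mulr0 M).
by apply: hinner_app => //; exact: close_form.
Qed.

Lemma hinner_iota2 v w : hinner (iota v) (iota w) = B v w.
Proof. exact: hinner_iota. Qed.

Lemma iota_linear (a : C) v w : iota (a *: v + w) = a *: iota v + iota w.
Proof. by apply/val_inj/funext => x /=; exact: form_linear. Qed.

Lemma snorm_iota v : snorm hsemi (iota v) = N v.
Proof. by rewrite /snorm [hsemi _ _]hinner_iota2. Qed.

Lemma hfun_le F w : `|F w : C| <= snorm hsemi F * N w.
Proof. by rewrite -hinner_iota -snorm_iota; exact: form_le. Qed.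

(** The square of the norm is close to [F v] for an approximant [v], and [F v] is at most [M * N v],
    where [N v] exceeds [M] by at most the error. Together with [hfun_le] this identifies the
    Hilbert norm with the norm of [F] as a functional. *)
Lemma snorm_bounded F (M : C) : 0 <= M -> bounded_by F M -> snorm hsemi F <= M.
Proof.
move=> M0 FM; rewrite -(@ler_pXn2r _ 2) ?nnegrE ?snorm_ge0 // snorm_sqr.
apply: complex_le_eps; rewrite ?exprn_ge0 ?form_ge0 // => e e0.
have [d d0 Md] := eps_split (addr_ge0 M0 M0) e0.
have /approxP/(_ _ d0)[v Fv] := hfunP F.
rewrite -[leLHS]ger0_norm ?form_ge0 // -[X in `|X|](subrK (F v : C)).
rewrite (le_trans (ler_normD _ _)) //.
have Fw : `|hinner F F - F v| <= M * d by apply: hinner_app => //; exact: ltW.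
rewrite (le_trans (lerD Fw (FM v))) //.
have Nv := ler_wpM2l M0 (close_norm (ltW d0) M0 FM Fv).
rewrite (le_trans (lerD (lexx _) Nv)) // mulrDr addrCA -expr2 lerD2l.
by rewrite -mulrDl.
Qed.

(** Null vectors of [B] are sent to the zero function, so the passage to functionals separates
    points without a quotient. *)
Lemma snorm_eq0 F : snorm hsemi F = 0 -> F = 0.
Proof.
move=> F0; apply/val_inj/funext => w; apply/eqP; rewrite -normr_le0.
by have := hfun_le F w; rewrite F0 mul0r.
Qed.

HB.instance Definition _ := Lmodule_isNormed.Build C H
  (snormD hsemi) (snormZ hsemi) snorm_eq0.

(** A Cauchy filter converges at every point of [V]. The estimates are uniform relative to [N], so
    the pointwise limit is again approximable and is the limit in norm. *)
Lemma hcompl_complete (Phi : set_system H) :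
  ProperFilter Phi -> cauchy Phi -> cvg Phi.
Proof.
move=> PF /cauchyP cPhi.
have near2 (e : C) : 0 < e -> exists2 F, Phi (ball F e) &
    forall G x, ball F e G -> `|(F x : C) - G x| <= e * N x.
  move=> e0; have [F PhiF] := cPhi _ e0; exists F => // G x.
  rewrite -ball_normE /= => FG.
  rewrite (_ : _ - _ = (F - G) x); last by [].
  by rewrite (le_trans (hfun_le _ _)) // ler_wpM2r ?snorm_ge0 // ltW.
have lim_at x : exists l : complex_line R, (fun F : H => F x) @ Phi --> l.
  apply/cvg_ex; apply: cauchy_cvg; apply: cauchy_exP => e e0.
  have [d d0 Nd] := eps_split (snorm_ge0 B x) e0.
  have [F PhiF FG] := near2 _ (divr_gt0 d0 (ltr0n _ 2)).
  exists (F x); rewrite /nbhs /=; apply: filterS PhiF => G /(FG G x) FGx.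
  rewrite -ball_normE /=; apply: le_lt_trans FGx _.
  apply: (@le_lt_trans _ _ (e / 2)); last by rewrite ltr_pdivrMr // ltr_pMr // ltr1n.
  by rewrite mulrC mulrA ler_pM2r ?invr_gt0.
have /choice[L LP] := lim_at.
have Lnear (e : C) F : 0 < e -> Phi (ball F e) ->
    (forall G x, ball F e G -> `|(F x : C) - G x| <= e * N x) ->
    forall x, `|(L x : C) - F x| <= e * N x.
  move=> e0 PhiF FG x; apply: complex_le_eps; rewrite ?mulr_ge0 ?snorm_ge0 // ?(ltW e0) // => d d0.
  have /cvgrPdist_le/(_ _ d0) Ld := LP x.
  have [G [/= LG FBG]] := filter_ex (filterI Ld PhiF).
  rewrite [leRHS]addrC -(subrKA (G x : C)) (le_trans (ler_normD _ _)) // lerD //.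
  by rewrite distrC FG.
have LA : L \in approx B.
  apply/approxP => e e0; have e2 : 0 < e / 2 by rewrite divr_gt0.
  have [F PhiF FG] := near2 _ e2; have LF := Lnear _ _ e2 PhiF FG.
  have /approxP/(_ _ e2)[v Fv] := hfunP F; exists v => x.
  by rewrite -(subrKA (F x : C)) (le_trans (ler_normD _ _)) // [e]splitr mulrDl lerD.
apply/cvg_ex; exists (HCompl LA); apply/cvgrPdist_le => e e0.
have e2 : 0 < e / 2 by rewrite divr_gt0.
have [F PhiF FG] := near2 _ e2; have LF := Lnear _ _ e2 PhiF FG.
apply: filterS PhiF => G FBG; apply: snorm_bounded; first exact: ltW.
move=> x; rewrite [X in `|X|](_ : _ = (L x : C) - G x) //.
rewrite -(subrKA (F x : C)) (le_trans (ler_normD _ _)) // [e]splitr mulrDl lerD //.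
exact: FG.
Qed.

HB.instance Definition _ := Uniform_isComplete.Build H hcompl_complete.

Lemma hinner_norm F : `|F| ^+ 2 = hinner F F.
Proof. exact: (snorm_sqr hsemi). Qed.

HB.instance Definition _ := isHilbert.Build R H hinner_linear hinner_conj hinner_norm.

End CompletionInner.

(** * Extension of isometries to the completion *)

Section CompletionIsometry.
Variables (R : realType) (V : lmodType R[i]) (B : semiInner V).
Variables T S : V -> V.
Hypothesis TS : forall v w, B (T v) w = B v (S w).
Hypothesis SN : forall w, snorm B (S w) = snorm B w.
Local Notation H := (hcompl B).

Lemma close_lift F v a : close B F v a -> close B (F \o S) (T v) a.
Proof. by move=> Fv x; rewrite TS -(SN x); exact: Fv. Qed.

Lemma lift_approx (F : H) : (F \o S : V -> complex_line R) \in approx B.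
Proof.
apply/approxP => e e0; have /approxP/(_ _ e0)[v Fv] := hfunP F.
by exists (T v); exact: close_lift.
Qed.

(** Since [B v (S w) = B (T v) w], composition with the adjoint [S] extends [T], and no limit has to
    be taken. *)
Definition hlift (F : H) : H := HCompl (lift_approx F).

Lemma hlift_linear : linear hlift.
Proof. by move=> a F G; apply/val_inj/funext. Qed.

HB.instance Definition _ := GRing.isLinear.Build R[i] H H _ hlift hlift_linear.

Lemma hlift_inner (F G : H) : cancel T S ->
  inner (hlift F) (hlift G) = inner F G.
Proof.
move=> TK; apply/eqP; rewrite -subr_eq0; apply/eqP/complex_eq0_eps => e e0.
have e2 : 0 < e / 2 by rewrite divr_gt0.
have [d1 d10 FG] := hinner_form F G e2.
have [d2 d20 FG'] := hinner_form (hlift F) (hlift G) e2.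
have [v Fv1 Fv2] := close_pair F d10 d20; have [w Gw1 Gw2] := close_pair G d10 d20.
rewrite -(subrKA (B v w)) (le_trans (ler_normD _ _)) // [e]splitr lerD //; last first.
  by rewrite distrC; exact: FG.
by rewrite -[w in B v w]TK -TS; apply: FG'; exact: close_lift.
Qed.

Lemma hlift_iota v : hlift (iota B v) = iota B (T v).
Proof. by apply/val_inj/funext => w /=; rewrite TS. Qed.

End CompletionIsometry.

(** * Positive definite kernels as Gram matrices *)

Definition gram (R : realType) (T : eqType) (K : T -> T -> R[i]) (s : seq T) : Prop :=
  exists (J : finType) (v : T -> J -> R[i]),
    {in s &, forall x y, K x y = \sum_j v x j * (v y j)^*}.

Section Gram.
Variables (R : realType) (T : eqType).
Implicit Types (K : T -> T -> R[i]) (s : seq T).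

Lemma gram_conj K s : gram K s -> {in s &, forall x y, K y x = (K x y)^*}.
Proof.
move=> [J [v vK]] x y xs ys; rewrite !vK // rmorph_sum.
by apply: eq_bigr => j _; rewrite rmorphM /= conjCK mulrC.
Qed.

Lemma gram_ge0 K s (c : T -> R[i]) : gram K s ->
  0 <= \sum_(x <- s) \sum_(y <- s) c x * (c y)^* * K x y.
Proof.
move=> [J [v vK]].
have -> : \sum_(x <- s) \sum_(y <- s) c x * (c y)^* * K x y =
    \sum_j `|\sum_(x <- s) c x * v x j| ^+ 2.
  transitivity (\sum_(x <- s) \sum_(y <- s) \sum_j (c x * v x j) * (c y * v y j)^*).
    rewrite big_seq [RHS]big_seq; apply: eq_bigr => x xs.
    rewrite big_seq [RHS]big_seq; apply: eq_bigr => y ys.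
    rewrite vK // mulr_sumr; apply: eq_bigr => j _.
    by rewrite rmorphM /= mulrACA.
  under eq_bigr do rewrite exchange_big.
  rewrite exchange_big; apply: eq_bigr => j _.
  by rewrite normCK rmorph_sum mulr_suml; apply: eq_bigr => x _; rewrite mulr_sumr.
by apply: sumr_ge0 => j _; rewrite exprn_ge0.
Qed.

Lemma eq_gram K K' s : {in s &, K =2 K'} -> gram K s -> gram K' s.
Proof.
by move=> KK' [J [v vK]]; exists J, v => x y xs ys; rewrite -KK' // vK.
Qed.

Lemma gram_rank1 (a : T -> R[i]) s : gram (fun x y => a x * (a y)^*) s.
Proof.
exists unit, (fun x _ => a x) => x y _ _.
by rewrite big_const cardT enumT unlock /= addr0.
Qed.

Lemma gram_eq (U : eqType) (f : T -> U) s :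
  gram (fun x y => (f x == f y)%:R : R[i]) s.
Proof.
pose i x := index (f x) (map f s).
(* The vector of [x] is the basis vector numbered by the first position of [f x] in the image
   list. *)
exists 'I_(size s), (fun x (j : Finite.sort _) => (i x == val j)%:R) => x y xs ys.
have ix z : z \in s -> (i z < size s)%N.
  by move=> zs; rewrite -(size_map f) index_mem map_f.
rewrite (bigD1 (Ordinal (ix x xs))) //= eqxx mul1r rmorph_nat big1 => [|j].
  rewrite addr0 eq_sym; congr (nat_of_bool _)%:R; apply/eqP/eqP.
    by rewrite /i => ->.
  by rewrite /i => e; rewrite -(nth_index (f y) (map_f f xs)) -e nth_index ?map_f.
by rewrite -val_eqE /= eq_sym => /negPf->; rewrite mul0r.
Qed.

(** Schur's product theorem: the vectors of the product are the tensor products. It is immediate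
    because [gram] asks for vectors and not for positivity of quadratic sums. *)
Lemma gram_mul K K' s : gram K s -> gram K' s -> gram (fun x y => K x y * K' x y) s.
Proof.
move=> [J [v vK]] [J' [v' vK']].
exists (J * J')%type, (fun x j => v x j.1 * v' x j.2) => x y xs ys.
rewrite vK // vK' // big_distrlr pair_big /=; apply: eq_bigr => j _.
by rewrite rmorphM /= mulrACA.
Qed.

Lemma gram_prod (I : Type) (r : seq I) (P : pred I) (K : I -> T -> T -> R[i]) s :
  (forall i, gram (K i) s) -> gram (fun x y => \prod_(i <- r | P i) K i x y) s.
Proof.
move=> Ks; elim: r => [|i r IHr].
  apply: eq_gram (gram_rank1 (fun=> 1) s) => x y _ _.
  by rewrite big_nil rmorph1 mul1r.
have [Pi|Pi] := boolP (P i).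
  by apply: eq_gram (gram_mul (Ks i) IHr) => x y _ _; rewrite big_cons Pi.
by apply: eq_gram IHr => x y _ _; rewrite big_cons (negPf Pi).
Qed.

End Gram.

Lemma gram_comp (R : realType) (T U : eqType) (f : T -> U) (K : U -> U -> R[i]) s :
  gram K (map f s) -> gram (fun x y => K (f x) (f y)) s.
Proof.
by move=> [J [v vK]]; exists J, (v \o f) => x y xs ys; rewrite vK ?map_f.
Qed.

Section GroupAlgebraMorph.
Variables (R : realType) (G : groupType).
Implicit Types (f h : galg R G) (x y : G).

Lemma glift_ltrans (W : lmodType R[i]) (phi : G -> W) x f :
  glift phi (ltrans x f) = glift (fun y => phi (x * y)%g) f.
Proof.
rewrite /ltrans (glift_comp _ _ (gliftP phi)).
by apply: eq_glift => y /=; rewrite glift_delta.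
Qed.

Lemma ltrans1 f : ltrans 1 f = f.
Proof. by rewrite /ltrans -[RHS]glift_id; apply: eq_glift => x; rewrite mul1g. Qed.

Lemma ltransK x : cancel (@ltrans R G x) (ltrans x^-1).
Proof. by move=> f; rewrite ltransM mulVg ltrans1. Qed.

End GroupAlgebraMorph.

(** * An algebra inside its completion *)

Section ToCompletion.
Variables (R : realType) (A : preCStarAlgType R).
Implicit Types a b : A.

Lemma to_completion0 : to_completion (0 : A) = 0.
Proof. by []. Qed.

Lemma to_completion1 : to_completion (1 : A) = 1.
Proof. by []. Qed.

Lemma to_completionM a b : to_completion (a * b) = to_completion a * to_completion b.
Proof.
rewrite /to_completion [RHS]Defs.pi_mul; congr (\pi_(completion A) _).
exact: cauchyseq_eq.
Qed.

Lemma to_completionS a : to_completion a^^* = (to_completion a)^^*.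
Proof.
rewrite /to_completion [RHS]Defs.pi_star; congr (\pi_(completion A) _).
exact: cauchyseq_eq.
Qed.

Lemma to_completion_linear (c : R[i]) a b :
  to_completion (c *: a + b) = c *: to_completion a + to_completion b.
Proof.
rewrite /to_completion [c *: \pi_(completion A) _]Defs.pi_scale [RHS]Defs.pi_add.
congr (\pi_(completion A) _).
exact: cauchyseq_eq.
Qed.

Lemma completion_cvg (x : completion A) : exists u : nat -> A,
  converges_to (fun n => to_completion (u n)) x.
Proof.
have /choice[u uP] n : exists a, cnorm (x - to_completion a) < n.+1%:R^-1.
  by apply: to_completion_dense; rewrite invr_gt0 ltr0n.
exists u => e e0; have /cvgrPdist_lt/(_ _ e0)[N _ PN] := @cvg_harmonic R.
exists N => n /PN /=; rewrite sub0r normrN ger0_norm ?invr_ge0 ?ler0n //.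
by rewrite cnorm_distC; exact/lt_trans/uP.
Qed.

End ToCompletion.

Lemma normc_le_eps (R : realType) (z : R[i]) (r : R) :
  (forall e, 0 < e -> `|z| <= (r + e)%:C) -> `|z| <= r%:C.
Proof.
by rewrite normc_re => zr; rewrite lecR; apply/ler_addgt0Pr => e /zr; rewrite lecR.
Qed.

Section ConvergesTo.
Variables (R : realType) (A : preCStarAlgType R).
Implicit Types (a l : A) (u : nat -> A).

Lemma converges_mull a u l : converges_to u l -> converges_to (fun n => a * u n) (a * l).
Proof.
move=> ul e e0; have a1 : 0 < cnorm a + 1 by rewrite ltr_wpDl ?cnorm_ge0.
have [N uN] := ul _ (divr_gt0 e0 a1); exists N => n /uN un.
rewrite -mulrBr; apply: le_lt_trans (cnormM _ _) _.
apply: (@le_lt_trans _ _ ((cnorm a + 1) * cnorm (u n - l))).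
  by rewrite ler_wpM2r ?cnorm_ge0 // lerDl.
by rewrite mulrC -ltr_pdivlMr.
Qed.

Lemma converges_star u l : converges_to u l -> converges_to (fun n => (u n)^^*) l^^*.
Proof. by move=> ul e /ul[N uN]; exists N => n /uN; rewrite -starB cnorm_star. Qed.

Lemma converges_mulr a u l : converges_to u l -> converges_to (fun n => u n * a) (l * a).
Proof.
move=> ul; have := converges_star (converges_mull a^^* (converges_star ul)).
by rewrite starM !starK => cv e /cv[N uN]; exists N => n /uN; rewrite starM !starK.
Qed.

End ConvergesTo.

(** * Extension of a state to the completion, and the ideal it defines *)

Section Extension.
Variables (R : realType) (A : preCStarAlgType R) (w : A -> R[i]).
Hypothesis w_linear : forall c a b, w (c *: a + b) = c * w a + w b.
Hypothesis w_le : forall a, `|w a| <= (cnorm a)%:C.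
Hypothesis w_star : forall a, w a^^* = (w a)^*.
Implicit Types (a b f : A) (p q : completion A).

Lemma functional0 : w 0 = 0.
Proof.
have := w_linear 1 0 0; rewrite scale1r addr0 mul1r => /eqP.
by rewrite -subr_eq subrr eq_sym => /eqP.
Qed.

Lemma functionalB a b : w (a - b) = w a - w b.
Proof.
by rewrite -[in LHS](scaleN1r b) addrC w_linear mulN1r addrC.
Qed.

Lemma cnorm_to a b : cnorm (to_completion a - to_completion b) = cnorm (a - b).
Proof. by rewrite -to_completionB; exact: completion_norm_to. Qed.

(** By density these inequalities determine [z]. They characterise the extension without a chosen
    sequence, and its linearity and symmetry are derived from them. *)
Lemma extension_exists p :
  exists z, forall a, `|z - w a| <= (cnorm (p - to_completion a))%:C.
Proof.
have [u up] := completion_cvg p; pose v n : complex_line R := w (u n).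
have vcvg : cvg (v @ \oo).
  apply: cauchy_cvg; apply: cauchy_exP => e e0.
  have eE : e = (complex.Re e)%:C by rewrite RRe_real // gtr0_real.
  have e2 : 0 < complex.Re e / 2 by rewrite divr_gt0 // -ltcR -eE.
  have [N uN] := up _ e2; exists (v N); exists N => // n /= Nn.
  rewrite -ball_normE /= -functionalB (le_lt_trans (w_le _)) // eE ltcR -cnorm_to.
  apply: le_lt_trans (cnorm_dist _ p _) _.
  by rewrite [ltRHS]splitr [X in _ + X < _]cnorm_distC ltrD ?uN.
have /cvg_ex[z /cvgrPdist_le vz] := vcvg.
exists z => a; apply: normc_le_eps => e e0.
have e2 : 0 < e / 2 by rewrite divr_gt0.
have [N uN] := up _ e2.
have [|M _ vM] := vz (e / 2)%:C; first by rewrite ltcR.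
pose n := maxn N M; have := vM n (leq_maxr _ _); have := uN n (leq_maxl _ _).
move=> un; rewrite /= => vn.
rewrite -(subrKA (w (u n))); apply: le_trans (ler_normD _ _) _.
rewrite -functionalB; apply: le_trans (lerD vn (w_le _)) _.
rewrite -rmorphD lecR -cnorm_to [e in leRHS]splitr addrCA lerD2l.
by apply: le_trans (cnorm_dist _ p _) _; rewrite [leLHS]addrC lerD2l ltW.
Qed.

Definition extension p : R[i] := sval (cid (extension_exists p)).

Lemma extensionP p a : `|extension p - w a| <= (cnorm (p - to_completion a))%:C.
Proof. exact: svalP (cid (extension_exists p)) a. Qed.

Lemma extension_to a : extension (to_completion a) = w a.
Proof.
by apply/eqP; rewrite -subr_eq0 -normr_le0 (le_trans (extensionP _ a)) // subrr cnorm0.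
Qed.

Lemma extension_le p : `|extension p| <= (cnorm p)%:C.
Proof. by have := extensionP p 0; rewrite functional0 to_completion0 !subr0. Qed.

Lemma extension_linear (c : R[i]) p q :
  extension (c *: p + q) = c * extension p + extension q.
Proof.
pose r := complex.Re `|c|; have r0 : 0 <= r by exact: normc_re_ge0.
have r2 : 0 < 2 * (r + 1) by rewrite mulr_gt0 // ltr_wpDl.
apply/eqP; rewrite -subr_eq0 -normr_le0 -[0 in leRHS]/(0%:C).
apply: normc_le_eps => e e0; rewrite add0r.
(* Each of the errors [z] and [z'] is at most [(r + 1) * d], which is [e / 2]. *)
have d0 := divr_gt0 e0 r2; set d := e / _ in d0.
have [a pa] := to_completion_dense p d0; have [b qb] := to_completion_dense q d0.
pose z := extension (c *: p + q) - w (c *: a + b).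
pose z' := c * (extension p - w a) + (extension q - w b).
rewrite (_ : _ - _ = z - z'); last first.
  rewrite /z /z' w_linear; move: (extension _) (extension _) (extension _) => x y t; ring.
have pqab : c *: p + q - to_completion (c *: a + b) =
    c *: (p - to_completion a) + (q - to_completion b).
  by rewrite to_completion_linear scalerBr opprD addrACA.
have le1 : cnorm (c *: (p - to_completion a) + (q - to_completion b)) <= (r + 1) * d.
  apply: le_trans (cnormD _ _) _; rewrite cnormZ_re mulrDl mul1r lerD ?(ltW qb) //.
  by rewrite ler_wpM2l // ltW.
have zle : `|z| <= ((r + 1) * d)%:C.
  by apply: le_trans (extensionP _ _) _; rewrite lecR pqab.
have z'le : `|z'| <= ((r + 1) * d)%:C.
  apply: le_trans (ler_normD _ _) _; rewrite normrM mulrDl mul1r rmorphD rmorphM /= -normc_re.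
  apply: lerD; first rewrite ler_wpM2l //.
    by apply: le_trans (extensionP _ _) _; rewrite lecR ltW.
  by apply: le_trans (extensionP _ _) _; rewrite lecR ltW.
apply: le_trans (ler_normB _ _) _; apply: le_trans (lerD zle z'le) _.
rewrite -rmorphD lecR -mulr2n -mulr_natl mulrA [d]/(e / _) mulrC divfK //.
by rewrite gt_eqF.
Qed.

Lemma extensionB p q : extension (p - q) = extension p - extension q.
Proof. by rewrite -[in LHS](scaleN1r q) addrC extension_linear mulN1r addrC. Qed.

Lemma extension_eps p z :
  (forall e, 0 < e -> exists2 a, cnorm (p - to_completion a) < e & `|z - w a| <= e%:C) ->
  extension p = z.
Proof.
move=> pz; apply/eqP; rewrite -subr_eq0 -normr_le0 -[0 in leRHS]/(0%:C).
apply: normc_le_eps => e e0; have [|a pa za] := pz (e / 2); first by rewrite divr_gt0.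
rewrite add0r -(subrKA (w a)); apply: le_trans (ler_normD _ _) _.
rewrite [e]splitr rmorphD lerD // ?(distrC _ z) //.
by apply: le_trans (extensionP _ _) _; rewrite lecR ltW.
Qed.

Lemma extension_star p : extension p^^* = (extension p)^*.
Proof.
apply: extension_eps => e e0; have [a pa] := to_completion_dense p e0.
exists a^^*; first by rewrite to_completionS -starB cnorm_star.
rewrite w_star -rmorphB norm_conjC; apply: le_trans (extensionP _ _) _.
by rewrite lecR ltW.
Qed.

Lemma extension_lim0 (u : nat -> completion A) p : converges_to u p ->
  (forall n, extension (u n) = 0) -> extension p = 0.
Proof.
move=> up u0; apply/eqP; rewrite -normr_le0 -[0 in leRHS]/(0%:C).
apply: normc_le_eps => e e0; rewrite add0r.
have [N /(_ N (leqnn N)) un] := up _ e0.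
rewrite -[extension _]subr0 -(u0 N) -extensionB; apply: le_trans (extension_le _) _.
by rewrite lecR cnorm_distC ltW.
Qed.

(** For a positive functional the numbers [extension (x * p * y)] are the matrix coefficients of [p]
    in its GNS representation, so this is the kernel of that representation. Written with the
    functional alone, it requires no representation of the completion. *)
Definition vanishing p : Prop := forall x y, extension (x * p * y) = 0.

Hypothesis w1 : w 1 = 1.

Lemma vanishing1 : ~ vanishing 1.
Proof.
move=> /(_ 1 1)/eqP; rewrite !mulr1.
by rewrite -to_completion1 extension_to w1 oner_eq0.
Qed.

Lemma vanishing0 : vanishing 0.
Proof. by move=> x y; rewrite mulr0 mul0r -to_completion0 extension_to functional0. Qed.

Lemma vanishingD p q : vanishing p -> vanishing q -> vanishing (p + q).
Proof.
move=> vp vq x y; rewrite mulrDr mulrDl -[x * p * y]scale1r extension_linear.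
by rewrite vp vq mulr0 addr0.
Qed.

Lemma vanishingMl q p : vanishing p -> vanishing (q * p).
Proof. by move=> vp x y; rewrite mulrA vp. Qed.

Lemma vanishingMr q p : vanishing p -> vanishing (p * q).
Proof. by move=> vp x y; rewrite -mulrA -(mulrA p) mulrA vp. Qed.

Lemma vanishingS p : vanishing p -> vanishing p^^*.
Proof.
move=> vp x y; rewrite -[_ * y]starK extension_star !starM starK mulrA vp.
by rewrite rmorph0.
Qed.

Definition vanishing_ideal : starIdeal (completion A) :=
  StarIdeal vanishing1 vanishing0 vanishingD vanishingMl vanishingMr vanishingS.

Lemma vanishing_closed : norm_closed vanishing.
Proof.
move=> u p vu up x y; apply: (extension_lim0 _ (fun n => vu n x y)).
exact/converges_mulr/converges_mull.
Qed.

Lemma vanishing_to a : (forall b d, w (b * a * d) = 0) -> vanishing (to_completion a).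
Proof.
move=> a0 x y; have [u ux] := completion_cvg x; have [v vy] := completion_cvg y.
apply: (extension_lim0 (converges_mulr y (converges_mulr _ ux))) => n.
apply: (extension_lim0 (converges_mull _ vy)) => m.
by rewrite -!to_completionM extension_to.
Qed.

Lemma vanishing_toP a : vanishing (to_completion a) -> w a = 0.
Proof. by move=> /(_ 1 1); rewrite mul1r mulr1 extension_to. Qed.

(** The first hypothesis makes all coefficients of [v^^* * v - 1] vanish. If [v * v^^*] were 1 in
    the quotient, [w] would take the value [w 1 = 1] on it. *)
Lemma nonfinite_quotient_of_isometry v :
  (forall b d, w (b * (v^^* * v) * d) = w (b * d)) -> w (v * v^^*) <> 1 ->
  has_nonfinite_quotient (completion A).
Proof.
move=> vv1 vv; exists vanishing_ideal; split; first exact: vanishing_closed.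
have piE a b : \pi_(quot vanishing_ideal) (to_completion a) =
    \pi_(quot vanishing_ideal) (to_completion b) <->
    vanishing (to_completion (a - b)).
  by rewrite to_completionB; exact: Defs.quotP.
pose z : quot vanishing_ideal := \pi_(quot vanishing_ideal) (to_completion v).
have pi1 : 1 = \pi_(quot vanishing_ideal) (to_completion 1).
  by rewrite to_completion1.
move=> /(_ z) [|_].
  rewrite /is_isometry /z [_^^*]Defs.pi_star [LHS]Defs.pi_mul -to_completionS -to_completionM.
  rewrite pi1; apply/piE; apply: vanishing_to => b d.
  by rewrite mulrBr mulrBl functionalB vv1 mulr1 subrr.
rewrite /z [_^^*]Defs.pi_star [LHS]Defs.pi_mul -to_completionS -to_completionM.
rewrite pi1 => /piE/vanishing_toP vv0; apply: vv; apply/eqP.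
by rewrite -subr_eq0 -w1 -functionalB vv0.
Qed.

End Extension.

(** * The GNS representation of a positive definite function *)

Section GNS.
Variables (R : realType) (G : groupType) (phi : G -> R[i]).
Hypothesis phi1 : phi 1%g = 1.
Hypothesis phi_gram : forall s : seq G, gram (fun x y => phi (y^-1 * x)%g) s.
Local Notation C := R[i].
Local Notation CG := (galg R G).
Implicit Types (f a b : CG) (x y h k : G).

(** The inner [glift] is linear in [b]; conjugating it gives the conjugate-linear variable, and the
    conjugation on [phi] cancels, as [gformE] shows. *)
Definition gform a b : C :=
  glift (fun x => (glift (fun y => (phi (y^-1 * x)%g)^* : complex_line R) b : C)^*
    : complex_line R) a.

Lemma gformE a b : gform a b =
  \sum_(x <- msupp a) \sum_(y <- msupp b) a@_x * (b@_y)^* * phi (y^-1 * x)%g.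
Proof.
apply: eq_bigr => x _.
rewrite [LHS](_ : _ = a@_x *
  (glift (fun y => (phi (y^-1 * x)%g)^* : complex_line R) b : C)^*) //.
rewrite /glift rmorph_sum mulr_sumr; apply: eq_bigr => y _.
by rewrite [_ *: _](_ : _ = b@_y * (phi (y^-1 * x)%g)^*) // rmorphM /= conjCK mulrA.
Qed.

Lemma phi_conj x y : phi (x^-1 * y)%g = (phi (y^-1 * x)%g)^*.
Proof. by apply: (gram_conj (phi_gram [:: x; y])); rewrite !inE eqxx ?orbT. Qed.

Lemma gform_linear (c : C) a b d : gform (c *: a + b) d = c * gform a d + gform b d.
Proof. exact: gliftP. Qed.

Lemma gform_conj a b : gform b a = (gform a b)^*.
Proof.
rewrite !gformE exchange_big rmorph_sum; apply: eq_bigr => x _.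
rewrite rmorph_sum; apply: eq_bigr => y _.
by rewrite !rmorphM /= conjCK -phi_conj [b@_y * _]mulrC.
Qed.

Lemma gform_ge0 a : 0 <= gform a a.
Proof. by rewrite gformE; exact: gram_ge0. Qed.

Definition gsemi : semiInner CG := SemiInner gform_linear gform_conj gform_ge0.

Lemma gsemi_trans x a b : gsemi (ltrans x a) b = gsemi a (ltrans x^-1 b).
Proof.
rewrite /= /gform glift_ltrans; apply: eq_glift => y; congr (_^*).
by rewrite glift_ltrans; apply: eq_glift => z; rewrite invgM invgK mulgA.
Qed.

Lemma snorm_ltrans x a : snorm gsemi (ltrans x a) = snorm gsemi a.
Proof. by rewrite /snorm gsemi_trans ltransK. Qed.

Local Notation H := (hcompl gsemi).

Definition gns x : {linear H -> H} :=
  hlift (gsemi_trans x) (snorm_ltrans x^-1).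

Lemma gns_unitary : unitary_rep gns.
Proof.
split=> [F|x y F|x F F'].
- by apply/val_inj/funext => a /=; rewrite invg1 ltrans1.
- by apply/val_inj/funext => a /=; rewrite invgM ltransM.
- by apply: hlift_inner; exact: ltransK.
Qed.

Lemma gns_eval f a : rep_eval gns f (iota gsemi a) = iota gsemi (f * a).
Proof.
rewrite [f * a]galg_mulE (glift_comp _ _ (@iota_linear _ _ gsemi)).
by apply: eq_glift => x; rewrite /gns /= hlift_iota.
Qed.

Definition state f : C := glift (phi : G -> complex_line R) f.

Lemma stateE f :
  state f = inner (rep_eval gns f (iota gsemi 1)) (iota gsemi (delta R 1)).
Proof.
rewrite gns_eval; apply: esym; apply: etrans (hinner_iota2 _ _ _) _.
rewrite mulr1; apply: eq_glift => x.
by rewrite glift_delta conjCK invg1 mul1g.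
Qed.

Lemma state_linear (c : C) a b : state (c *: a + b) = c * state a + state b.
Proof. exact: gliftP. Qed.

Lemma state_star f : state f^^* = (state f)^*.
Proof.
rewrite !stateE (rep_eval_star gns_unitary f); exact: inner_conj.
Qed.

(** The state is a coefficient of [gns] at a unit vector, and [gns] is one of the representations in
    the supremum. This is where a complete Hilbert space is needed. *)
Lemma state_le f : `|state f| <= (max_norm f)%:C.
Proof.
have n1 : snorm gsemi (delta R 1%g) = 1.
  rewrite /snorm [gsemi _ _](_ : _ = 1) ?sqrtC1 //.
  by apply: etrans (glift_delta _ _) _; rewrite glift_delta conjCK mulVg phi1.
rewrite stateE (le_trans (form_le (hsemi gsemi) _ _)) // snorm_iota n1 mulr1.
apply: (max_norm_unit f gns_unitary).
by rewrite -n1 -(snorm_iota gsemi).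
Qed.

Lemma state_delta x : state (delta R x) = phi x.
Proof. exact: glift_delta. Qed.

End GNS.

(** * A non-unitary isometry from a projection and a shift *)

Section ShiftCriterion.
Variables (R : realType) (A : preCStarAlgType R) (G : groupType) (D : G -> A).
Hypothesis DM : forall x y, D x * D y = D (x * y)%g.
Hypothesis D1 : D 1%g = 1.
Hypothesis D_star : forall x, (D x)^^* = D x^-1%g.
Hypothesis D_ind : forall P : A -> Prop, P 0 ->
  (forall (c : R[i]) x a, P a -> P (c *: D x + a)) -> forall a, P a.
Variable w : A -> R[i].
Hypothesis w_linear : forall c a b, w (c *: a + b) = c * w a + w b.
Hypothesis w_le : forall a, `|w a| <= (cnorm a)%:C.
Hypothesis w_star : forall a, w a^^* = (w a)^*.
Hypothesis w1 : w 1 = 1.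
Implicit Types (a b : A) (h k x : G).

(** In GNS terms this is the inner product of [a] and [D h], both applied to the cyclic vector. As
    the [D h] span, these numbers determine the vector given by [a]. *)
Definition coef h a : R[i] := w (D h^-1 * a).

Lemma coef_linear h (c : R[i]) a b : coef h (c *: a + b) = c * coef h a + coef h b.
Proof. by rewrite /coef mulrDr -scalerAr w_linear. Qed.

Lemma coef0 h : coef h 0 = 0.
Proof. by rewrite /coef mulr0 functional0. Qed.

Lemma coefD h a b : coef h (a + b) = coef h a + coef h b.
Proof. by rewrite -[a]scale1r coef_linear mul1r scale1r. Qed.

Lemma coefB h a b : coef h (a - b) = coef h a - coef h b.
Proof. by rewrite /coef mulrBr functionalB. Qed.

Lemma coef_trans h x a : coef h (D x * a) = coef (x^-1 * h)%g a.
Proof. by rewrite /coef mulrA DM invgM invgK. Qed.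

Lemma coef_star h k a : coef h (a^^* * D k) = (coef k (a * D h))^*.
Proof.
by rewrite /coef -w_star !starM !D_star invgK mulrA.
Qed.

Lemma nonfinite_quotient_of_coef v :
  (forall h k, coef h (v^^* * v * D k) = coef h (D k)) ->
  coef 1%g (v * v^^*) <> 1 -> has_nonfinite_quotient (completion A).
Proof.
rewrite /coef invg1 D1 mul1r => vv1 vv.
apply: (nonfinite_quotient_of_isometry w_linear w_le w_star w1) vv => b d.
elim/D_ind: d => [|c k d IHd]; first by rewrite !mulr0.
rewrite !mulrDr -!scalerAr !w_linear IHd; congr (_ * _ + _).
elim/D_ind: b {IHd} => [|c' h b IHb]; first by rewrite !mul0r.
rewrite !mulrDl -!scalerAl !w_linear IHb; congr (_ * _ + _).
by have := vv1 h^-1%g k; rewrite invgK !mulrA.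
Qed.

Variables (p : A) (u : G) (chi : pred G).
Hypothesis p_chi : forall h k, coef h (p * D k) = (chi h)%:R * coef h (D k).
Hypothesis w_chi : forall h k, chi h != chi k -> coef h (D k) = 0.

Lemma coef_proj h a : coef h (p * a) = (chi h)%:R * coef h a.
Proof.
elim/D_ind: a => [|c k a IHa]; first by rewrite mulr0 coef0 mulr0.
by rewrite mulrDr -scalerAr !coef_linear IHa p_chi mulrDr mulrCA.
Qed.

(** The projection given by [p] is self-adjoint: taking the adjoint yields the factor [chi k] in
    place of [chi h], and by [w_chi] the coefficient vanishes unless the two agree. *)
Lemma coef_proj_star h a : coef h (p^^* * a) = (chi h)%:R * coef h a.
Proof.
elim/D_ind: a => [|c k a IHa]; first by rewrite mulr0 coef0 mulr0.
rewrite mulrDr -scalerAr !coef_linear IHa coef_star p_chi mulrDr.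
rewrite mulrCA; congr (_ * _ + _).
rewrite rmorphM /= rmorph_nat -[D h]mul1r -coef_star star1 mul1r.
have [->//|hk] := eqVneq (chi h) (chi k).
by rewrite w_chi // !mulr0.
Qed.

Let v := D u * p + 1 - p.

Lemma coef_shift h a : coef h (v * a) =
  (chi (u^-1 * h)%g)%:R * coef (u^-1 * h)%g a + (1 - (chi h)%:R) * coef h a.
Proof.
rewrite /v mulrBl mulrDl mul1r coefB coefD -mulrA coef_trans !coef_proj.
by rewrite mulrBl mul1r addrA.
Qed.

Lemma coef_shift_star h a : coef h (v^^* * a) =
  (chi h)%:R * coef (u * h)%g a + (1 - (chi h)%:R) * coef h a.
Proof.
rewrite /v starB starD starM star1 D_star.
rewrite mulrBl mulrDl mul1r coefB coefD -mulrA !coef_proj_star coef_trans invgK.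
by rewrite mulrBl mul1r addrA.
Qed.

(* With [P] the projection given by [p] and [U] the unitary given by [u], the
   hypothesis on [chi] says that U P U^* <= P, whence the isometry U P + 1 - P;
   it is not surjective when U P U^* <> P. *)
Lemma nonfinite_of_shift : (forall h, chi h -> chi (u * h)%g) ->
  chi 1%g -> ~~ chi u^-1%g -> has_nonfinite_quotient (completion A).
Proof.
move=> chi_u chi1 /negPf chiV; apply: (nonfinite_quotient_of_coef (v := v)) => [h k|].
  rewrite -mulrA coef_shift_star !coef_shift mulKg.
  have [hh|hh] := boolP (chi h).
    by rewrite chi_u //= subrr !mul0r !addr0 !mul1r.
  have [uh|uh] := boolP (chi (u^-1 * h)%g).
    by have := chi_u _ uh; rewrite mulVKg (negPf hh).
  by rewrite /= subr0 !mul0r !add0r !mul1r.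
(* Both weights in [coef_shift] vanish at 1: the cyclic vector is orthogonal to the range of [v]. *)
rewrite -[v^^*]mulr1 coef_shift mulg1 chiV chi1 /= subrr !mul0r addr0.
by move/esym/eqP; rewrite oner_eq0.
Qed.

End ShiftCriterion.

(** * The criterion for group C*-algebras *)

Section GroupAlgebra.
Variables (R : realType) (G : groupType).
Local Notation CG := (galg R G).

Lemma galg_ind (P : CG -> Prop) : P 0 ->
  (forall (c : R[i]) x a, P a -> P (c *: delta R x + a)) -> forall a, P a.
Proof.
move=> P0 Pc a; rewrite -(glift_id a) gliftE.
elim: (msupp a : seq G) => [|x s IHs]; first by rewrite lincomb_nil.
by rewrite lincomb_cons; exact: Pc.
Qed.

Lemma delta_mul (x y : G) : delta R x * delta R y = delta R (x * y)%g.
Proof. exact: deltaM. Qed.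

Lemma delta_star (x : G) : (delta R x)^^* = delta R x^-1%g.
Proof. exact: galg_star_delta. Qed.

Variable phi : G -> R[i].
Hypothesis phi1 : phi 1%g = 1.
Hypothesis phi_gram : forall s : seq G, gram (fun x y => phi (y^-1 * x)%g) s.

Lemma state_mul_delta (L : groupType) (e : L -> G) (q : galg R L) h k :
  state phi (delta R h * (glift (fun l => delta R (e l)) q * delta R k)) =
  glift (fun l => phi (h * (e l * k))%g : complex_line R) q.
Proof.
pose T (a : CG) : complex_line R := state phi (delta R h * (a * delta R k)).
have linT : linear T.
  by move=> c a b; rewrite /T mulrDl mulrDr -scalerAl -scalerAr state_linear.
apply: etrans (glift_comp (fun l => delta R (e l)) q linT) _; apply: eq_glift => l /=.
rewrite /T.
by rewrite !delta_mul state_delta.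
Qed.

Lemma nonfinite_of_positive_definite (p : CG) (u : G) (chi : pred G) :
  (forall h k, state phi (delta R h^-1 * (p * delta R k)) =
    (chi h)%:R * phi (h^-1 * k)%g) ->
  (forall h k, chi h != chi k -> phi (h^-1 * k)%g = 0) ->
  (forall h, chi h -> chi (u * h)%g) -> chi 1%g -> ~~ chi u^-1%g ->
  has_nonfinite_quotient (full_cstar R G).
Proof.
move=> p_chi phi_chi.
apply: (nonfinite_of_shift delta_mul (erefl _) delta_star galg_ind
  (state_linear phi) (state_le phi1 phi_gram) (state_star phi_gram) _ (p := p)).
- exact: etrans (state_delta _ _) phi1.
- by move=> h k; apply: etrans (p_chi h k) _; rewrite /coef delta_mul state_delta.
- by move=> h k hk; rewrite /coef delta_mul state_delta phi_chi.
Qed.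

End GroupAlgebra.

(** * The positive definite function on the wreath product *)

Section WreathState.
Variables (R : realType) (Lambda Gamma : groupType).
Local Notation C := R[i].
Local Notation W := (wreath Lambda Gamma).
Local Open Scope group_scope.
Variables (psi : Lambda -> C) (q : galg R Lambda) (S : pred Gamma).
Hypothesis psi1 : psi 1 = 1%R.
Hypothesis psi_gram : forall s : seq Lambda, gram (fun x y => psi (y^-1 * x)) s.
Hypothesis q0 : glift (fun=> 1%R : complex_line R) q = 0%R.
Hypothesis psi_q : forall a b,
  glift (fun x => psi (a * x * b) : complex_line R) q = psi (a * b).
Implicit Types (g h k : W) (r t : Gamma).

Definition wphi g : C :=
  ((wtop g == 1%g)%:R * \prod_(r <- finsupp (wbase g) | S r) psi (wbase g r))%R.

Lemma wphiE g (D : {fset Gamma}) : (finsupp (wbase g) `<=` D)%fset ->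
  wphi g = ((wtop g == 1%g)%:R * \prod_(r <- D | S r) psi (wbase g r))%R.
Proof.
move=> gD; congr (_ * _)%R; rewrite big_mkcond [RHS]big_mkcond /=.
by apply: big_fset_incl => // r _ gr; rewrite fsfun_dflt // psi1 if_same.
Qed.

Lemma wphi1 : wphi 1 = 1%R.
Proof.
rewrite /wphi eqxx mul1r big1 // => r _.
by rewrite [wbase _ _]wreath_oneE psi1.
Qed.

Lemma wtop_mul g h : wtop (g * h) = wtop g * wtop h.
Proof. by []. Qed.

Lemma wtop_inv g : wtop g^-1 = (wtop g)^-1.
Proof. by []. Qed.

Lemma wbase_quot g h r : wbase (h^-1 * g) r =
  (wbase h (wtop h * r))^-1 * wbase g (wtop h * r).
Proof. by rewrite [LHS]wreath_mulE wreath_invE invgK. Qed.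

Lemma wtop_quot g h : (wtop (h^-1 * g) == 1) = (wtop g == wtop h).
Proof. by rewrite wtop_mul wtop_inv -(inj_eq (mulgI (wtop h))) mulVKg mulg1. Qed.

(** When the tops agree, [wtop h] may be replaced by [wtop g] in the second factor. Each factor is
    then the kernel of [psi] pulled back along the single map sending [g] to [wbase g (wtop g * r)],
    the form that [gram_comp] requires. That map is the inverse of [wbase g^-1 r], hence the
    supports of the inverses. *)
Lemma wphi_quot g h (D : {fset Gamma}) :
  (finsupp (wbase g^-1) `<=` D)%fset -> (finsupp (wbase h^-1) `<=` D)%fset ->
  wphi (h^-1 * g) = ((wtop g == wtop h)%:R *
    \prod_(r <- D | S r) psi ((wbase h (wtop h * r))^-1 * wbase g (wtop g * r))%g)%R.
Proof.
move=> gD hD.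
have [gh|gh] := eqVneq (wtop g) (wtop h); last first.
  by rewrite /wphi wtop_quot (negPf gh) !mul0r.
have inv1 k r : (finsupp (wbase k^-1) `<=` D)%fset -> r \notin D -> wbase k (wtop k * r) = 1.
  move=> /fsubsetP kD rD; apply: invg_inj; rewrite invg1 -wreath_invE.
  by rewrite fsfun_dflt //; apply: contra rD => /kD.
rewrite (@wphiE _ D).
  rewrite wtop_quot gh eqxx; congr (_ * _)%R.
  by apply: eq_bigr => r _; rewrite wbase_quot.
apply/fsubsetP => r; rewrite mem_finsupp; apply: contraNT => rD.
by rewrite wbase_quot -{2}gh (inv1 h) // (inv1 g) // invg1 mulg1.
Qed.

Lemma wphi_gram (s : seq W) : gram (fun g h => wphi (h^-1 * g)) s.
Proof.
pose D := (\bigcup_(g <- s) finsupp (wbase g^-1))%fset.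
pose K r g h : C := psi ((wbase h (wtop h * r))^-1 * wbase g (wtop g * r))%g.
apply: (@eq_gram _ _
  (fun g h => (wtop g == wtop h)%:R * \prod_(r <- D | S r) K r g h)%R).
  move=> g h gs hs; rewrite (@wphi_quot _ _ D) //; exact: bigfcup_sup.
apply: gram_mul; first exact: gram_eq.
apply: gram_prod => r.
exact: (gram_comp (f := fun g => wbase g (wtop g * r)) (psi_gram _)).
Qed.

Definition wembed (l : Lambda) : W := Wreath [fsfun x in [fset 1]%fset => l] 1.

Lemma wembedE l r : wbase (wembed l) r = if r == 1 then l else 1.
Proof. by rewrite fsfun_fun in_fset1. Qed.

(** Translation by [h^-1] carries the site 1 to [(wtop h)^-1], so [l] enters one factor only, and
    that factor is present exactly when [S] contains this site. The other factors form [c], which is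
    0 if the tops of [h] and [k] differ. *)
Lemma wphi_embed h k : exists a b (c : C), forall l,
  wphi (h^-1 * (wembed l * k)) = ((if S (wtop h)^-1%g then psi (a * l * b)%g else 1) * c)%R.
Proof.
pose r0 := (wtop h)^-1.
pose D := (r0 |` (finsupp (wbase h^-1) `|` finsupp (wbase k^-1)))%fset.
exists (wbase h 1)^-1, (wbase k 1), ((wtop k == wtop h)%:R *
  \prod_(r <- (D `\ r0)%fset | S r) psi ((wbase h (wtop h * r))^-1 * wbase k (wtop k * r))%g)%R
  => l.
have topk : wtop (wembed l * k) = wtop k by rewrite wtop_mul mul1g.
have basek r : wbase (wembed l * k) r = (if r == 1 then l else 1) * wbase k r.
  by rewrite [LHS]wreath_mulE wembedE /= invg1 mul1g.
have [kh|kh] := eqVneq (wtop k) (wtop h); last first.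
  by rewrite /wphi wtop_quot topk (negPf kh) !mul0r mulr0.
rewrite (@wphi_quot _ _ D); last 2 first.
- apply/fsubsetP => r; rewrite mem_finsupp [wbase _ _]wreath_invE topk basek.
  rewrite !inE !mem_finsupp; case: (eqVneq (wtop k * r) 1) => [r1 _|r1].
    by rewrite /r0 -kh -(inj_eq (mulgI (wtop k))) r1 mulgV eqxx.
  by rewrite mul1g [wbase k^-1 r]wreath_invE => ->; rewrite !orbT.
- by apply/fsubsetP => r rh; rewrite !inE rh orbT.
rewrite topk kh eqxx !mul1r big_mkcond /= (big_fsetD1 r0) ?fset1U1 //=.
rewrite -big_mkcond /= basek mulgV eqxx mulgA; congr (_ * _)%R.
rewrite big_seq_cond [RHS]big_seq_cond; apply: eq_bigr => r /andP[].
rewrite !inE => /andP[rr0 _] _; rewrite basek.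
by rewrite -{1}(mulgV (wtop h)) (inj_eq (mulgI _)) (negPf rr0) mul1g.
Qed.

(** As a function of [l] the coefficient is a multiple of [psi (a * l * b)] or a constant. Against
    [q] the former gives its value at [l = 1] by [psi_q], the latter gives 0 by [q0]. *)
Lemma wphi_project h k :
  (state wphi (delta R h^-1%g * (glift (fun l => delta R (wembed l)) q * delta R k)) =
  (S (wtop h)^-1%g)%:R * wphi (h^-1 * k)%g)%R.
Proof.
have [a [b [c E]]] := wphi_embed h k.
apply: etrans (state_mul_delta _ _ _ _ _) _.
have embed1 : wembed 1 = 1.
  by apply: wreath_eq => // r; rewrite wembedE if_same wreath_oneE.
have := E 1; rewrite embed1 mul1g => ->.
under eq_glift do rewrite E mulrC.
rewrite -[LHS]/(glift (fun x => c *: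
  ((if S (wtop h)^-1%g then psi (a * x * b)%g else 1) : complex_line R))%R q).
rewrite gliftZ -[LHS]/(c * _)%R mulrC.
case: (S _); first by rewrite psi_q mulg1 mul1r.
by rewrite q0 !mul0r.
Qed.

Lemma wreath_nonfinite t : S 1 -> ~~ S t -> (forall r, S r -> S (r * t^-1)) ->
  has_nonfinite_quotient (full_cstar R W).
Proof.
move=> S1 St Srt.
apply: (nonfinite_of_positive_definite wphi1 wphi_gram
  (p := glift (fun l => delta R (wembed l)) q) (u := Wreath (wbase (1 : W)) t)
  (chi := fun h => S (wtop h)^-1)).
- exact: wphi_project.
- move=> h k hk; rewrite /wphi wtop_quot.
  have [kh|_] := eqVneq (wtop k) (wtop h); last by rewrite mul0r.
  by rewrite kh eqxx in hk.
- by move=> h /Srt; rewrite wtop_mul invgM.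
- by rewrite invg1.
- by rewrite wtop_inv invgK.
Qed.

End WreathState.

(** The last clause tests [q] between all translates of the cyclic vector, so that [q] acts as 1 on
    the whole GNS space of [psi]. *)
Definition separating_state (R : realType) (G : groupType)
    (psi : G -> R[i]) (q : galg R G) : Prop :=
  [/\ psi 1%g = 1, forall s : seq G, gram (fun x y => psi (y^-1 * x)%g) s,
      glift (fun=> 1 : complex_line R) q = 0 &
      forall a b, glift (fun x => psi (a * x * b)%g : complex_line R) q = psi (a * b)%g].

(** * The separating state of a central element *)

Section CentralElement.
Variables (R : realType) (G : groupType) (c : G).
Hypothesis c_neq1 : c <> 1%g.
Hypothesis c_central : forall x, (c * x = x * c)%g.
Local Notation C := R[i].

Lemma exists_character : exists om : C,
  [/\ om != 1, `|om| = 1 & forall n, (c ^+ n = 1)%g -> om ^+ n = 1].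
Proof.
have [[n n0 cn]|cinf] := pselect (exists2 n, (0 < n)%N & (c ^+ n = 1)%g); last first.
  exists (-1); split; rewrite ?normrN1 //; last first.
    by case=> // n cn; case: cinf; exists n.+1.
  by rewrite -subr_eq0 -opprD oppr_eq0 -[_ + _]/(2%:R) pnatr_eq0.
have ex : exists n, (0 < n)%N && `[< (c ^+ n = 1)%g >].
  by exists n; rewrite n0; apply/asboolP.
case: (ex_minnP ex) => m /andP[m0 /asboolP cm] mmin {n n0 cn ex}.
have m1 : (1 < m)%N.
  by case: m m0 cm {mmin} => [|[|m]] // _; rewrite expg1.
(* A root of 1 + X + ... + X^(m-1) is an m-th root of unity, and it is not 1 because the value at 1
   is m. *)
pose p : {poly C} := \poly_(i < m) 1.
have sp : size p = m.
  by case: m m0 @p {cm mmin m1} => // m _ p; apply: size_poly_eq; exact: oner_neq0.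
have /closed_rootP[om /rootP omp] : size p != 1 by rewrite sp gtn_eqF.
have om0 : \sum_(i < m) om ^+ i = 0.
  by rewrite -[RHS]omp horner_poly; apply: eq_bigr => i _; rewrite mul1r.
have omm : om ^+ m = 1.
  by apply/eqP; rewrite -subr_eq0 subrX1 om0 mulr0.
exists om; split.
- apply: contra_eq_neq om0 => ->; under eq_bigr do rewrite expr1n.
  by rewrite sumr_const card_ord pnatr_eq0 -lt0n.
- by apply/eqP; rewrite -(@pexpr_eq1 _ _ m) // -normrX omm normr1.
move=> k ck; have km : (c ^+ (k %% m) = 1)%g.
  by move: ck; rewrite {1}(divn_eq k m) expgnDr mulnC expgnA cm expg1n mul1g.
have : (k %% m = 0)%N.
  apply/eqP; rewrite -leqn0 leqNgt; apply/negP => k0.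
  have := mmin (k %% m)%N; rewrite k0 /= leqNgt ltn_pmod // => mm.
  by have /asboolP/mm := km.
by move=> k0; rewrite (divn_eq k m) k0 addn0 mulnC exprM omm expr1n.
Qed.

Variable om : C.
Hypothesis om_neq1 : om != 1.
Hypothesis om_norm : `|om| = 1.
Hypothesis om_c : forall n, (c ^+ n = 1)%g -> om ^+ n = 1.

Lemma om_neq0 : om != 0.
Proof. by rewrite -normr_eq0 om_norm oner_eq0. Qed.

Lemma om_eq m n : (c ^+ m = c ^+ n)%g -> om ^+ m = om ^+ n.
Proof.
wlog mn : m n / (m <= n)%N.
  by move=> H e; case: (leqP m n) => [mn|/ltnW nm]; [exact: H|exact/esym/H/esym].
move=> e; have cnm : (c ^+ (n - m) = 1)%g.
  by rewrite expgnFr // -e mulgV.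
by rewrite -(subnKC mn) exprD (om_c cnm) mulr1.
Qed.

(** The elements lie in one left coset of the subgroup generated by [c]; a pair of natural exponents
    encodes an integer one. *)
Definition coset_rel (x y : G) (mn : nat * nat) : Prop :=
  (x * c ^+ mn.1 = y * c ^+ mn.2)%g.

(** The character of the subgroup generated by [c] that sends [c] to [om], extended by 0; [cpsiE]
    shows that the chosen exponents do not matter. *)
Definition cpsi (x : G) : C :=
  if pselect (exists mn, coset_rel x 1%g mn) is left H
  then om ^+ (projT1 (cid H)).2 / om ^+ (projT1 (cid H)).1 else 0.

Lemma cpsiE x m n : (x * c ^+ m = c ^+ n)%g -> cpsi x = om ^+ n / om ^+ m.
Proof.
move=> xmn; rewrite /cpsi; case: pselect => [H|]; last first.
  by case; exists (m, n); rewrite /coset_rel mul1g.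
case: (cid H) => -[m' n'] cmn /=; have := cmn; rewrite /coset_rel /= mul1g => xmn'.
have om0 k : om ^+ k != 0 by rewrite expf_neq0 // om_neq0.
apply/eqP; rewrite eqr_div // -!exprD; apply/eqP/om_eq.
by rewrite !expgnDr -xmn -xmn' -!mulgA -!expgnDr [in LHS]addnC.
Qed.

Lemma cpsi_out x : (forall mn, ~ coset_rel x 1%g mn) -> cpsi x = 0.
Proof. by move=> nx; rewrite /cpsi; case: pselect => // H; have [mn /nx] := H. Qed.

Definition coset_of (x : G) : set G := [set y | exists mn, coset_rel x y mn].

Lemma coset_of_eq x y : coset_of x y -> coset_of x = coset_of y.
Proof.
move=> [[m n] /= xy]; apply/seteqP; split => z [[k l]]; rewrite /coset_rel /= => e.
  exists (k + n, m + l)%N; rewrite /coset_rel /=.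
  by rewrite addnC expgnDr mulgA -xy -mulgA -expgnDr addnC expgnDr mulgA e -mulgA -expgnDr addnC.
exists (m + k, l + n)%N; rewrite /coset_rel /=.
by rewrite expgnDr mulgA xy -mulgA -expgnDr addnC expgnDr mulgA e -mulgA -expgnDr.
Qed.

Lemma coset_of_refl x : coset_of x x.
Proof. by exists (0, 0)%N. Qed.

(** With a representative [r x] in each coset, the kernel is the indicator of equal cosets times a
    kernel of rank one, the character of [(r x)^-1 * x]. *)
Lemma cpsi_gram (s : seq G) : gram (fun x y => cpsi (y^-1 * x)%g) s.
Proof.
pose r x := xget 1%g (coset_of x).
have rP x : coset_of x (r x) by apply: xgetPex; exists x; exact: coset_of_refl.
have om0 k : om ^+ k != 0 by rewrite expf_neq0 // om_neq0.
have conj_om k : (om ^+ k)^* = (om ^+ k)^-1.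
  by rewrite invC_norm normrX om_norm expr1n expr1n invr1 mul1r.
apply: (@eq_gram _ _ (fun x y => (coset_of x == coset_of y)%:R *
    (cpsi ((r x)^-1 * x)%g * (cpsi ((r y)^-1 * y)%g)^*))); last first.
  by apply: gram_mul; [exact: gram_eq|exact: gram_rank1].
move=> x y _ _; have [xy|xy] := eqVneq (coset_of x) (coset_of y); last first.
  rewrite mul0r cpsi_out // => -[m n]; rewrite /coset_rel /= mul1g => e.
  move/eqP: xy; apply; apply: coset_of_eq; exists (m, n); rewrite /coset_rel /=.
  by rewrite -e !mulgA mulgV mul1g.
have rxy : r x = r y by rewrite /r xy.
have [[m n] /= xr] := rP x; have [[k l] /= yr] := rP y.
rewrite /coset_rel /= in xr yr.
have -> : cpsi ((r x)^-1 * x)%g = om ^+ n / om ^+ m.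
  by apply: cpsiE; rewrite -mulgA xr mulKg.
have -> : cpsi ((r y)^-1 * y)%g = om ^+ l / om ^+ k.
  by apply: cpsiE; rewrite -mulgA yr mulKg.
have -> : cpsi (y^-1 * x)%g = om ^+ (k + n) / om ^+ (m + l).
  apply: cpsiE; rewrite expgnDr -mulgA (mulgA x) xr rxy -mulgA -expgnDr addnC.
  by rewrite expgnDr (mulgA (r y)) -yr -mulgA -expgnDr mulKg.
rewrite mul1r rmorphM fmorphV /= !conj_om invrK !exprD invfM.
by move: (om ^+ n) (om ^+ k) (om ^+ m)^-1 (om ^+ l)^-1 => a1 a2 a3 a4; ring.
Qed.

(** The central [c] acts as the scalar [om], so [c - 1] acts as [om - 1], which the coefficient
    normalises to 1; in the trivial representation [c - 1] is 0. *)
Lemma central_separating_state : separating_state cpsi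
  ((om - 1)^-1 *: (delta R c - delta R 1%g)).
Proof.
have om1 : om - 1 != 0 by rewrite subr_eq0.
split; first by rewrite -(divr1 1) -(expr0 om); apply: cpsiE; rewrite mul1g.
- exact: cpsi_gram.
- by rewrite linearZ linearB /= !glift_delta subrr scaler0.
move=> a b; rewrite linearZ linearB /= !glift_delta mulg1 -mulgA c_central mulgA.
have -> : cpsi (a * b * c)%g = om * cpsi (a * b)%g.
  have [[[m n]]|nab] := pselect (exists mn, coset_rel (a * b)%g 1%g mn).
    rewrite /coset_rel /= mul1g => e.
    rewrite (cpsiE e) (@cpsiE _ m n.+1) ?exprS ?mulrA //.
    by rewrite expgSr -e -!mulgA -!expgS -!expgSr.
  rewrite !cpsi_out ?mulr0 // => -[m n] e; apply: nab.
    by exists (m, n).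
  exists (m.+1, n); rewrite /coset_rel /= -[RHS]e /=.
  by rewrite expgS mulgA.
rewrite -[X in _ *: (_ - X)]mul1r -mulrBl -[LHS]/(_ * (_ * _)).
by rewrite mulrA mulVf // mul1r.
Qed.

End CentralElement.

(** * Hilbert-Schmidt geometry and units of matrix *-algebras *)

Section HilbertSchmidt.
Variables (R : realType) (d : nat).
Local Notation C := R[i].
Local Notation M := 'M[C]_d.
Local Open Scope sesquilinear_scope.
Implicit Types a b x : M.

Definition hs a b : C := \tr (a *m b^t*).

Lemma hsE a b : hs a b = \sum_i \sum_j a i j * (b i j)^*.
Proof.
apply: eq_bigr => i _; rewrite mxE; apply: eq_bigr => j _.
by rewrite !mxE.
Qed.

Lemma hs_linear (c : C) a b x : hs (c *: a + b) x = c * hs a x + hs b x.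
Proof. by rewrite /hs mulmxDl -scalemxAl mxtraceD mxtraceZ. Qed.

Lemma hs_conj a b : hs b a = (hs a b)^*.
Proof.
rewrite !hsE rmorph_sum; apply: eq_bigr => i _; rewrite rmorph_sum.
by apply: eq_bigr => j _; rewrite rmorphM /= conjCK mulrC.
Qed.

Lemma hs_ge0 a : 0 <= hs a a.
Proof.
rewrite hsE; apply: sumr_ge0 => i _; apply: sumr_ge0 => j _.
by rewrite -normCK exprn_ge0.
Qed.

Definition hs_semi : semiInner M := SemiInner hs_linear hs_conj hs_ge0.

Lemma hsBl a b x : hs (a - b) x = hs a x - hs b x.
Proof. exact: (formBl hs_semi). Qed.

Lemma hsZl (c : C) a x : hs (c *: a) x = c * hs a x.
Proof. exact: (formZl hs_semi). Qed.

Lemma hsZr (c : C) a x : hs x (c *: a) = c^* * hs x a.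
Proof. exact: (formZr hs_semi). Qed.

Lemma hs_suml n (c : 'I_n -> C) (F : 'I_n -> M) x :
  hs (\sum_i c i *: F i) x = \sum_i c i * hs (F i) x.
Proof.
elim/big_rec2: _ => [|i y a _ <-]; first exact: (form0l hs_semi).
exact: hs_linear.
Qed.

Lemma hs_eq0 a : hs a a = 0 -> a = 0.
Proof.
rewrite hsE => /eqP; rewrite psumr_eq0 => [/allP a0|i _]; last first.
  by apply: sumr_ge0 => j _; rewrite -normCK exprn_ge0.
apply/matrixP => i j; rewrite mxE.
have := a0 i (mem_index_enum i); rewrite /= psumr_eq0 => [/allP ai0|k _]; last first.
  by rewrite -normCK exprn_ge0.
by have := ai0 j (mem_index_enum j); rewrite /= -normCK expf_eq0 normr_eq0 => /eqP.
Qed.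

Lemma orthonormal_size k (F : 'I_k -> M) :
  (forall i j, hs (F i) (F j) = (i == j)%:R) -> (k <= d * d)%N.
Proof.
move=> FO; pose A : 'M[C]_(k, d * d) := \matrix_i mxvec (F i).
suff AA : A *m A^t* = 1%:M by exact: mulmx1_min AA.
apply/matrixP => i j.
rewrite [in RHS]mxE -FO hsE pair_big mxE (reindex _ (curry_mxvec_bij _ _)) /=.
by apply: eq_bigr => -[r s] _; rewrite !mxE !mxvecE.
Qed.

Variable J : M -> Prop.
Hypothesis J0 : J 0.
Hypothesis J_linear : forall (c : C) a b, J a -> J b -> J (c *: a + b).

(** Gram-Schmidt on a subspace given only as a predicate: as long as the combination of the [F i] is
    not the projection of [x], some element of [J] detects this and yields one more orthonormal
    vector. For [k] above [d * d] the first alternative is impossible. *)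
Lemma orthonormal_or_projection x k :
  (exists2 F : 'I_k -> M, forall i, J (F i) & forall i j, hs (F i) (F j) = (i == j)%:R) \/
  exists2 e, J e & forall b, J b -> hs (x - e) b = 0.
Proof.
have J_sum (n : nat) (c : 'I_n -> C) (F : 'I_n -> M) : (forall i, J (F i)) ->
    J (\sum_i c i *: F i).
  move=> JF; elim/big_ind: _ => // [a b Ja Jb|i _].
    by rewrite -[a]scale1r; exact: J_linear.
  by rewrite -[_ *: _]addr0; exact: J_linear.
elim: k => [|k [[F JF FO]|]]; last by right.
  by left; exists (fun=> 0) => [[]|[]].
have proj y j : hs (y - \sum_i hs y (F i) *: F i) (F j) = 0.
  rewrite hsBl hs_suml (bigD1 j) //= FO eqxx mulr1 big1 ?addr0 ?subrr // => i ij.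
  by rewrite FO (negPf ij) mulr0.
have [[e Je eP]|noproj] := pselect (exists2 e, J e & forall b, J b -> hs (x - e) b = 0).
  by right; exists e.
left.
have Je : J (\sum_i hs x (F i) *: F i) by exact: J_sum.
have [b Jb xb] : exists2 b, J b & hs (x - \sum_i hs x (F i) *: F i) b <> 0.
  apply: contrapT => nb; apply: noproj; eexists; first exact: Je.
  by move=> b Jb; apply: contrapT => xb; apply: nb; exists b.
pose z := b - \sum_i hs b (F i) *: F i.
have Jz : J z by rewrite /z addrC -scaleN1r; apply: J_linear => //; exact: J_sum.
(* Were [z] zero, [b] would be a combination of the [F i], to which the residue of [x] is
   orthogonal. *)
have z0 : hs z z != 0.
  apply/eqP => /hs_eq0 z0; apply: xb; rewrite -(subrK (\sum_i hs b (F i) *: F i) b).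
  rewrite -/z z0 add0r hs_conj hs_suml big1 ?rmorph0 // => i _.
  by rewrite [hs (F i) _]hs_conj proj rmorph0 mulr0.
pose s := sqrtC (hs z z); have s0 : s != 0 by rewrite sqrtC_eq0.
have ss : s * s^* = hs z z.
  by rewrite -normCK ger0_norm ?sqrtC_ge0 ?hs_ge0 // sqrtCK.
exists (fun i => oapp F (s^-1 *: z) (unlift ord_max i)) => [i|i j].
  case: unliftP => [i' _|_] /=; first exact: JF.
  by rewrite -[_ *: _]addr0; exact: J_linear.
case: (unliftP ord_max i) => [i' ->|->]; case: (unliftP ord_max j) => [j' ->|->] /=.
- by rewrite FO (inj_eq lift_inj).
- rewrite hs_conj hsZl proj mulr0 rmorph0.
  by rewrite eq_sym (negPf (neq_lift _ _)).
- by rewrite hsZl proj mulr0 (negPf (neq_lift _ _)).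
rewrite hsZl hsZr fmorphV -ss eqxx.
by rewrite mulrCA mulKf // mulVf // conjC_eq0.
Qed.

Lemma projection_exists x : exists2 e, J e & forall b, J b -> hs (x - e) b = 0.
Proof.
have [[F _ /orthonormal_size]|//] := orthonormal_or_projection x (d * d).+1.
by rewrite ltnn.
Qed.

Hypothesis J_mul : forall a b, J a -> J b -> J (a *m b).
Hypothesis J_star : forall a, J a -> J (a^t*).

(* If [e] is the orthogonal projection of 1 onto the *-algebra [J], then 1 - e is
   orthogonal to (1 - e) a a^* for [a] in [J], that is, (1 - e) a = 0. *)
Lemma left_unit_exists : exists2 e, J e & forall a, J a -> e *m a = a.
Proof.
have [e Je eP] := projection_exists 1%:M; exists e => // a Ja.
have JB b b' : J b -> J b' -> J (b - b').
  by move=> Jb Jb'; rewrite addrC -scaleN1r; exact: J_linear.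
apply/esym/eqP; rewrite -subr_eq0; apply/eqP/hs_eq0.
have := eP ((1%:M - e) *m (a *m a^t*)).
have Jaa : J (a *m a^t*) by apply: J_mul => //; exact: J_star.
rewrite {1}mulmxBl mul1mx => /(_ (JB _ _ Jaa (J_mul Je Jaa))).
have -> : a - e *m a = (1%:M - e) *m a by rewrite mulmxBl mul1mx.
by rewrite /hs !(trmx_mul, map_mxM) trmxCK /= !mulmxA.
Qed.

End HilbertSchmidt.

(** * The separating state of a finite dimensional representation *)

Section GliftMorphism.
Variables (R : realType) (G : groupType) (V : lmodType R[i]) (phi : G -> V).
Implicit Types f g : galg R G.

Lemma glift_mul (m : V -> V -> V) f g :
  (forall b, linear (m^~ b)) -> (forall a, linear (m a)) ->
  (forall x y, phi (x * y)%g = m (phi x) (phi y)) ->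
  glift phi (f * g) = m (glift phi f) (glift phi g).
Proof.
move=> ml mr mM; rewrite [f * g]galg_mulE (glift_comp _ _ (gliftP phi)).
apply: esym; apply: etrans (glift_comp _ _ (ml _)) _; apply: eq_glift => x /=.
rewrite glift_ltrans; apply: etrans (glift_comp _ _ (mr _)) _.
by apply: eq_glift => y /=.
Qed.

Lemma glift_star (s : V -> V) f :
  (forall (c : R[i]) a b, s (c *: a + b) = (c^*) *: s a + s b) ->
  (forall x, phi x^-1%g = s (phi x)) ->
  glift phi f^^* = s (glift phi f).
Proof.
move=> sl sV; have s0 : s 0 = 0.
  by have := sl (-1) 0 0; rewrite scaler0 addr0 rmorphN rmorph1 scaleN1r addNr.
elim/galg_ind: f => [|c x f IHf].
  by rewrite star0 linear0 s0.
rewrite starD starZ delta_star !linearP /= IHf sl.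
by rewrite !glift_delta sV.
Qed.

End GliftMorphism.

Section FiniteDimensional.
Variables (R : realType) (G : groupType) (d : nat) (rho : G -> 'M[R[i]]_d).
Local Notation C := R[i].
Local Open Scope sesquilinear_scope.
Hypothesis rho_unitary : unitary_mxrep rho.
Variable x0 : G.
Hypothesis rho_x0 : rho x0 <> 1%:M.
Implicit Types (x y : G) (f g : galg R G).

Lemma rhoM x y : rho (x * y)%g = rho x *m rho y.
Proof. by case: rho_unitary. Qed.

Lemma rhoK x : (rho x)^t* *m rho x = 1%:M.
Proof. by case: rho_unitary => rU _; apply/mulmx1C/unitarymxP/rU. Qed.

Lemma rho1 : rho 1%g = 1%:M.
Proof.
by rewrite -[LHS]mul1mx -(rhoK 1%g) -mulmxA -rhoM mulg1.
Qed.

Lemma rhoV x : rho x^-1%g = (rho x)^t*.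
Proof.
by rewrite -[LHS]mul1mx -(rhoK x) -mulmxA -rhoM mulgV rho1 mulmx1.
Qed.

Definition augmentation f : C := glift (fun=> 1 : complex_line R) f.

Lemma augmentation_linear (c : C) f g :
  augmentation (c *: f + g) = c * augmentation f + augmentation g.
Proof. exact: gliftP. Qed.

(** The image under [rho] of the augmentation ideal, a *-algebra of matrices. Its unit is the
    projection onto the orthogonal complement of the vectors fixed by the group. *)
Definition aug_image (a : 'M[C]_d) : Prop :=
  exists2 f, augmentation f = 0 & glift rho f = a.

Lemma mulmx_linear_l (b : 'M[C]_d) : linear (mulmx^~ b : 'M[C]_d -> 'M[C]_d).
Proof. by move=> c a a'; rewrite mulmxDl scalemxAl. Qed.

Lemma mulmx_linear_r (a : 'M[C]_d) : linear (mulmx a : 'M[C]_d -> 'M[C]_d).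
Proof. by move=> c b b'; rewrite mulmxDr scalemxAr. Qed.

Lemma glift_rhoM f g : glift rho (f * g) = glift rho f *m glift rho g.
Proof. by apply: glift_mul rhoM; [exact: mulmx_linear_l|exact: mulmx_linear_r]. Qed.

Lemma augmentationM f g : augmentation (f * g) = augmentation f * augmentation g.
Proof.
apply: (glift_mul (m := fun a b : complex_line R => (a : C) * b)).
- by move=> b c a a'; rewrite mulrDl; congr (_ + _); exact/esym/mulrA.
- by move=> b c a a'; rewrite mulrDr; congr (_ + _); exact: mulrCA.
- by move=> x y; rewrite mulr1.
Qed.

Lemma aug_image0 : aug_image 0.
Proof. by exists 0; rewrite ?linear0 // /augmentation linear0. Qed.

Lemma aug_image_linear (c : C) a b :
  aug_image a -> aug_image b -> aug_image (c *: a + b).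
Proof.
move=> [f f0 <-] [g g0 <-]; exists (c *: f + g); last by rewrite linearP.
by rewrite augmentation_linear f0 g0 mulr0 addr0.
Qed.

Lemma aug_imageM f a : aug_image a -> aug_image (glift rho f *m a).
Proof.
move=> [g g0 <-]; exists (f * g); last exact: glift_rhoM.
by rewrite augmentationM g0 mulr0.
Qed.

Lemma aug_image_star a : aug_image a -> aug_image (a^t*).
Proof.
move=> [f f0 <-]; exists f^^*.
  rewrite /augmentation (glift_star (s := fun z : complex_line R => (z : C)^*)).
  - by rewrite -[glift _ _]/(augmentation _) f0 rmorph0.
  - by move=> c z t; rewrite rmorphD /= rmorphM.
  - by move=> x; rewrite rmorph1.
apply: (glift_star (s := fun a : 'M[C]_d => a^t*)) rhoV => c b b'.
by apply/matrixP => i j; rewrite !mxE rmorphD rmorphM.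
Qed.

(* The unit of the image of the augmentation ideal: [glift rho q = e] acts as the
   identity on the space of the representation [a |-> rho x *m a] generated by [e],
   while [q] vanishes in the trivial representation. *)
Lemma fin_dim_separating_state : exists psi (q : galg R G), separating_state psi q.
Proof.
have [e [q q0 qe] eP] : exists2 e, aug_image e & forall a, aug_image a -> e *m a = a.
  apply: left_unit_exists.
  - exact: aug_image0.
  - exact: aug_image_linear.
  - by move=> a b [f _ <-]; exact: aug_imageM.
  - exact: aug_image_star.
have e_aug : aug_image e by exists q.
(* Non-triviality of [rho] enters here: [rho x0 - 1] lies in the image, and a zero unit would
   annihilate it. *)
have e0 : e != 0.
  apply/eqP => e0; apply: rho_x0; apply/eqP; rewrite -subr_eq0.
  rewrite -(eP (rho x0 - 1%:M)) ?e0 ?mul0mx //.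
  exists (delta R x0 - delta R 1%g); last by rewrite linearB /= !glift_delta rho1.
  by rewrite /augmentation linearB /= !glift_delta subrr.
pose N := hs e e; have N0 : N != 0 by apply: contra_neq e0; exact: hs_eq0.
pose s := sqrtC N; have ss : s * s^* = N.
  by rewrite -normCK ger0_norm ?sqrtC_ge0 ?hs_ge0 // sqrtCK.
pose psi x : C := hs (rho x *m e) e / N.
have ere x : e *m (rho x *m e) = rho x *m e.
  by apply: eP; rewrite -(glift_delta rho x); exact: aug_imageM.
exists psi, q; split.
- by rewrite /psi rho1 mul1mx divff.
- move=> t; exists ('I_d * 'I_d)%type, (fun x j => (rho x *m e) j.1 j.2 / s) => x y _ _.
  transitivity (hs (rho x *m e) (rho y *m e) / N).
    rewrite /psi /hs trmx_mul map_mxM rhoM rhoV; congr (_ / _).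
    by rewrite [in RHS]mulmxA [in RHS]mxtrace_mulC !mulmxA.
  rewrite hsE pair_big mulr_suml; apply: eq_bigr => j _ /=.
  by rewrite -ss rmorphM fmorphV invfM mulrACA.
- exact: q0.
move=> a b; pose T (m : 'M[C]_d) : complex_line R := hs (rho a *m m *m rho b *m e) e / N.
have linT : linear T.
  move=> c m m'; rewrite /T !(mulmxDr, mulmxDl) -!(scalemxAr, scalemxAl).
  by rewrite hs_linear mulrDl -mulrA.
rewrite (@eq_glift _ _ _ _ (T \o rho)) => [|x]; last by rewrite /T /= /psi !rhoM.
apply: etrans (esym (glift_comp rho q linT)) _.
rewrite qe /T /psi; have -> // : rho a *m e *m rho b *m e = rho (a * b)%g *m e.
by rewrite rhoM -!mulmxA ere.
Qed.

End FiniteDimensional.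

(** * The separating state of a finite conjugacy class *)

Section FiniteClass.
Variables (R : realType) (G : groupType) (c : G).
Local Notation C := R[i].
Local Open Scope sesquilinear_scope.
Hypothesis c_finite : finite_set [set (c ^ x)%g | x in [set: G]].

(** The permutation representation on the class of [c]. Conjugation is a right action; with its
    source as row index the matrices multiply in the order of the group. *)
Lemma conjugation_mxrep : (exists x, (c ^ x)%g <> c) ->
  exists (d : nat) (rho : G -> 'M[C]_d), unitary_mxrep rho /\ exists x, rho x <> 1%:M.
Proof.
move=> [x0 cx0]; have [s0 sE] := (finite_seqP _).1 c_finite.
pose s := undup s0; have s_uniq : uniq s by exact: undup_uniq.
have sP y : (y \in s) <-> exists x, (c ^ x)%g = y.
  rewrite mem_undup; split=> [ys|[x <-]].
    have : [set` s0] y by [].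
    by rewrite -sE => -[x _ <-]; exists x.
  have : [set (c ^ x)%g | x in [set: G]] (c ^ x)%g by exists x.
  by rewrite sE.
pose e (i : 'I_(size s)) := tnth (in_tuple s) i.
have eI : injective e by exact/tuple_uniqP.
have eX i x : exists j, (e i ^ x)%g = e j.
  have /sP[y ey] : e i \in s by exact: mem_tnth.
  have : (e i ^ x)%g \in s by apply/sP; exists (y * x)%g; rewrite conjgM ey.
  by move=> /(tnthP (in_tuple s))[j ej]; exists j.
pose rho x : 'M[C]_(size s) := \matrix_(i, j) ((e i ^ x)%g == e j)%:R.
exists (size s), rho; split; last first.
  exists x0 => /matrixP rho1.
  have /(tnthP (in_tuple s))[i ci] : c \in s by apply/sP; exists 1%g; rewrite conjg1.
  have := rho1 i i; rewrite !mxE [e i](esym ci) eqxx; case: eqP => // _ /esym/eqP.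
  by rewrite oner_eq0.
have sum_e i x (F : 'I_(size s) -> C) k : (e i ^ x)%g = e k ->
    \sum_j ((e i ^ x)%g == e j)%:R * F j = F k.
  move=> ->; rewrite (bigD1 k) //= eqxx mul1r big1 ?addr0 // => j jk.
  by rewrite (inj_eq eI) eq_sym (negPf jk) mul0r.
split=> [x|x y]; last first.
  apply/matrixP => i j; rewrite !mxE; have [k ek] := eX i x.
  under eq_bigr do rewrite !mxE.
  by rewrite (sum_e _ _ _ _ ek) conjgM ek.
apply/unitarymxP/matrixP => i j; rewrite !mxE; have [k ek] := eX i x.
under eq_bigr do rewrite !mxE.
rewrite (sum_e _ _ _ _ ek) rmorph_nat -ek.
by rewrite (inj_eq (can_inj (conjgK x))) (inj_eq eI) eq_sym.
Qed.

Lemma finite_class_separating_state : c <> 1%g ->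
  exists psi (q : galg R G), separating_state psi q.
Proof.
move=> c1; have [[x cx]|central] := pselect (exists x, (c ^ x)%g <> c).
  have [d [rho [rhoU [y rhoy]]]] := conjugation_mxrep (ex_intro _ x cx).
  exact: fin_dim_separating_state rhoU _ rhoy.
have [om [om1 omN omc]] := exists_character R c1.
exists (cpsi c om), ((om - 1)^-1 *: (delta R c - delta R 1%g)).
apply: central_separating_state => // x.
have cx : (c ^ x)%g = c by apply: contrapT => cx; apply: central; exists x.
by rewrite conjgC cx.
Qed.

End FiniteClass.

Theorem theorem3p4 (R : realType) (Gamma Lambda : groupType)
    (Gamma_countable : countable [set: Gamma])
    (Lambda_countable : countable [set: Lambda])
    (Gamma_non_torsion : non_torsion Gamma)
    (Lambda_hyp : has_nontrivial_fin_dim_rep R Lambda \/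
                  has_nontrivial_finite_class Lambda) :
  has_nonfinite_quotient (full_cstar R (wreath Lambda Gamma)).
Proof.
have [psi [q [psi1 psi_gram q0 psi_q]]] :
    exists psi (q : galg R Lambda), separating_state psi q.
  case: Lambda_hyp => [[d [rho [_ rhoU [x rhox]]]]|[c [c1 cfin]]].
    exact: fin_dim_separating_state rhoU _ rhox.
  exact: finite_class_separating_state cfin c1.
have [t t_inf] := Gamma_non_torsion.
apply: (wreath_nonfinite (S := fun r => `[< exists n, (r = t^-1 ^+ n)%g >])
  psi1 psi_gram q0 psi_q (t := t)).
- by apply/asboolP; exists 0%N.
(* If t were t^-n, then t^(n+1) would be 1. *)
- apply/asboolP => -[n tn]; apply: (t_inf n.+1) => //.
  by rewrite expgS {1}tn -expgMn ?mulVg ?expg1n //; rewrite /commute mulVg mulgV.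
- by move=> r /asboolP[n ->]; apply/asboolP; exists n.+1; rewrite expgSr.
Qed.
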